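(* There exists $g_0$ such that every graph $G$ of Euler genus $g\ge g_0$ satisfies $\chi_o(G)\le g^{6400}$.
   Context: All graphs are finite and simple. An oriented graph is a directed graph with no loops, no multiple arcs and no pair of opposite arcs; an orientation of a graph $G$ assigns one direction to each edge. For an oriented graph $\vec G$, an oriented coloring is a proper vertex coloring $\phi$ such that for any two arcs $uv$ and $v'u'$ of $\vec G$, $(\phi(u),\phi(v))\ne(\phi(u'),\phi(v'))$; $\chi_o(\vec G)$ is the minimum number of colors in an oriented coloring. For an undirected graph $G$, $\chi_o(G)$ is the maximum of $\chi_o(\vec G)$ over all orientations $\vec G$ of $G$. The Euler genus of a surface $S$ is $2-\chi(S)$ where $\chi(S)$ is the Euler characteristic; the Euler genus of a graph is the minimum Euler genus of a surface in which it embeds. *)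

(* Defs.v *)
From mathcomp Require Import all_boot all_order all_algebra.
From mathcomp Require Import all_classical all_reals.
From mathcomp Require Import topology normedtype.

Set Implicit Arguments.
Unset Strict Implicit.
Unset Printing Implicit Defensive.

Import Order.TTheory GRing.Theory Num.Theory.
Import numFieldNormedType.Exports.

Section OrientedColoring.
Variable T : finType.
Implicit Types (e : rel T) (D : {set T * T}).

(* Digraphs on T are given by their sets of arcs. *)

Definition oriented_graph D : bool :=
  [forall u, forall v, ((u, v) \in D) ==> ((v, u) \notin D)].

Definition orientation e D : bool :=
  [forall u, forall v,
     if e u v then ((u, v) \in D) (+) ((v, u) \in D) else (u, v) \notin D].

Definition oriented_coloring D (k : nat) (phi : {ffun T -> 'I_k}) : bool :=
  [forall u, forall v, ((u, v) \in D) ==> (phi u != phi v)] &&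
  [forall u, forall v, forall u', forall v',
     ((u, v) \in D) && ((v', u') \in D) ==>
       ((phi u, phi v) != (phi u', phi v'))].

Definition oriented_colorable D (k : nat) : bool :=
  [exists phi : {ffun T -> 'I_k}, oriented_coloring D phi].

Lemma orientation_oriented e D :
  symmetric e -> orientation e D -> oriented_graph D.
Proof.
move=> se /forallP oD; apply/forallP => u; apply/forallP => v.
apply/implyP => uv; have /forallP/(_ v) := oD u.
by case: (e u v); rewrite uv.
Qed.

Lemma oriented_colorable_card D : oriented_graph D -> oriented_colorable D #|T|.
Proof.
move=> /forallP oD; have nD u v : (u, v) \in D -> (v, u) \notin D.
  by have /forallP/(_ v)/implyP := oD u.
apply/existsP; exists [ffun u => enum_rank u]; apply/andP; split.
  apply/forallP => u; apply/forallP => v; apply/implyP => uv.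
  rewrite !ffunE; apply/eqP => /enum_rank_inj E.
  by move: (uv) (nD _ _ uv); rewrite E => ->.
apply/forallP => u; apply/forallP => v; apply/forallP => u'.
apply/forallP => v'; apply/implyP => /andP[uv vu'].
apply/eqP; rewrite !ffunE => -[/enum_rank_inj E1 /enum_rank_inj E2].
by move: (nD _ _ uv); rewrite E1 E2 vu'.
Qed.

(* By [oriented_colorable_card], the minimum over all k is attained at some
   k <= #|T|. *)
Definition oriented_chi D : nat :=
  [arg min_(k < (ord_max : 'I_#|T|.+1) | oriented_colorable D k) (k : nat)].

Definition graph_oriented_chi e : nat :=
  \max_(D : {set T * T} | orientation e D) oriented_chi D.

End OrientedColoring.

Local Open Scope ring_scope.
Local Open Scope classical_set_scope.

Definition homeomorphic (X Y : topologicalType) (A : set X) (B : set Y) : Prop :=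
  exists (f : X -> Y) (g : Y -> X),
    [/\ {within A, continuous f} /\ {within B, continuous g},
        (forall x, A x -> B (f x)), (forall y, B y -> A (g y)),
        (forall x, A x -> g (f x) = x) & (forall y, B y -> f (g y) = y)].

(* Connected closed surface: nonempty compact connected 2-manifold. *)
Definition closed_surface (R : realType) (S : topologicalType) : Prop :=
  [/\ [set: S] !=set0, compact [set: S], hausdorff_space S,
      connected [set: S] &
      forall x : S, exists2 U : set S,
        open_nbhs x U & homeomorphic U [set: 'rV[R]_2]].

Section Complexes.
Variable W : finType.
Implicit Types K : {set {set W}}.

Definition simplicial_complex K : Prop :=
  (finset.set0 \notin K)%SET /\
  forall s t : {set W},
    s \in K -> t \subset s -> (t != finset.set0)%SET -> t \in K.

Definition simplices K (d : nat) : {set {set W}} :=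
  [set s in K | #|s| == d.+1]%SET.

(* Geometric realization, in barycentric coordinates. *)
Definition realization (R : realType) K : set 'rV[R]_#|W| :=
  [set x | [/\ forall w, 0 <= x 0 (enum_rank w),
               \sum_w x 0 (enum_rank w) = 1 &
               [set w | x 0 (enum_rank w) != 0]%SET \in K]].

(* Complexes obtained by pasting triangles pairwise along their edges; this
   holds for every complex whose realization is a closed surface. *)
Definition closed_2complex K : Prop :=
  [/\ simplicial_complex K,
      forall s, s \in K -> exists2 t, t \in simplices K 2 & s \subset t &
      forall s, s \in simplices K 1 ->
        #|[set t in simplices K 2 | s \subset t]%SET| = 2%N].

Definition euler_char K : int :=
  #|simplices K 0|%:Z - #|simplices K 1|%:Z + #|simplices K 2|%:Z.

Definition triangulates (R : realType) (S : topologicalType) K : Prop :=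
  closed_2complex K /\ homeomorphic (@realization R K) [set: S].

End Complexes.

Arguments realization [W] R K _.

Definition surface_euler_genus (R : realType) (S : topologicalType) (g : nat) :
    Prop :=
  exists (W : finType) (K : {set {set W}}),
    triangulates R S K /\ g%:Z = 2 - euler_char K.

(* A graph as a 1-dimensional complex. *)
Definition graph_complex (T : finType) (e : rel T) : {set {set T}} :=
  [set s : {set T} | [exists u, s == [set u]] ||
     [exists u, exists v, e u v && (s == [set u; v])]]%SET.

Definition embeds (R : realType) (T : finType) (e : rel T)
    (S : topologicalType) : Prop :=
  exists B : set S, homeomorphic (realization R (graph_complex e)) B.

Definition graph_euler_genus (R : realType) (T : finType) (e : rel T)
    (g : nat) : Prop :=
  (exists S : topologicalType,
     [/\ closed_surface R S, surface_euler_genus R S g & embeds R e S]) /\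
  (forall (S : topologicalType) (h : nat),
     closed_surface R S -> surface_euler_genus R S h -> embeds R e S ->
     (g <= h)%N).

(* Main.v *)
(** A topological embedding of G in a triangulated surface makes G a
    minor of the 1-skeleton of every sufficiently fine subdivision of the
    triangulation: thicken the (disjoint, compact) images of vertex stars and
    edge middles to the lattice vertices whose open stars they meet.

    Every simple minor of a triangulated closed surface of Euler genus g with n
    vertices has at most 3n + 3g edges.  Contracting spanning trees of the blocks
    and deleting all edges but one per adjacent pair merges the triangles into
    at least F - #(deleted edges) faces, each of length at least 3.

    This bound for the 1-subdivision-minors of G yields at most g vertices Y and
    an ordering of the others in which every vertex has at most 24 earlier
    neighbors and boundedly many earlier vertices share a later neighbor with it.
    A greedy coloring giving distinct colors to the earlier neighbors of every
    vertex is acyclic, and the orientations are encoded as in Raspaud and Sopena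
    by one bit per color; the at most 24 neighbors in Y are recorded explicitly,
    for O(g^24) colors in total. *)
From mathcomp Require Import all_boot zify.

Set Implicit Arguments.
Unset Strict Implicit.
Unset Printing Implicit Defensive.

(** * Contractions of triangulated surfaces *)

(** The embedding is only assumed continuous, so faces of the graph itself cannot be traced; what
    survives of it is that connected compact pieces stay connected and disjoint ones stay apart, and
    this is exactly what a minor needs. Faces appear only in the triangulation, where the parity of
    cuts replaces any Jordan-type argument.

    Sparsity of minors, not just of subgraphs, is needed because two vertices with a common later
    neighbor are joined by an edge of a minor and not by an edge of G.

    While more than g vertices remain, the edge bound gives average degree at most 2 (3 + 3) = 12,
    both for G and, up to a constant factor, for such pairs; the two weighted together give 24. At g
    vertices the averaging stops, which explains the size of Y. *)

Section CutConnected.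
Variables (V : finType) (adj : rel V).
Implicit Types A B S : {set V}.

(** Connectivity by cuts instead of paths is the form that topological connectedness yields, and it
    passes to unions without concatenating walks. The empty set satisfies it, so families of blocks
    may have empty members. *)
Definition cut_connected A := forall S,
  (exists2 x, x \in A & x \in S) -> ~~ (A \subset S) ->
  exists x y, [/\ x \in A :&: S, y \in A :\: S & adj x y].

Lemma cut_connected1 a : cut_connected [set a].
Proof. by move=> S [x /set1P-> aS]; rewrite sub1set aS. Qed.

Lemma cut_connected2 a b : symmetric adj -> adj a b -> cut_connected [set a; b].
Proof.
move=> sym ab S [x xab xS] /subsetPn[y yab yS].
exists x, y; rewrite !inE xS yS -in_set2 xab -in_set2 yab; split=> //.
move: xab yab; rewrite !inE => /orP[]/eqP ex /orP[]/eqP ey; subst x y => //.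
- by rewrite xS in yS.
- by rewrite sym.
- by rewrite xS in yS.
Qed.

Lemma cut_connected_bigcup (I : finType) (P : pred I) (F : I -> {set V}) a :
  (forall i, P i -> cut_connected (F i)) -> (forall i, P i -> a \in F i) ->
  cut_connected (\bigcup_(i | P i) F i).
Proof.
move=> cF aF S [x /bigcupP[i Pi xi] xS] /subsetPn[y /bigcupP[j Pj yj] yS].
have [k Pk [u [v [uk vk uv]]]] : exists2 k, P k & exists u v,
    [/\ u \in F k :&: S, v \in F k :\: S & adj u v].
  have [aS|aS] := boolP (a \in S).
    exists j => //; apply: cF => //; first by exists a => //; exact: aF.
    by apply/subsetPn; exists y.
  exists i => //; apply: cF => //; first by exists x.
  by apply/subsetPn; exists a => //; exact: aF.
exists u, v; split=> //.
  by move: uk; rewrite !inE => /andP[uk ->]; rewrite andbT; apply/bigcupP; exists k.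
by move: vk; rewrite !inE => /andP[-> vk]; apply/bigcupP; exists k.
Qed.

Lemma cut_connectedU A B a : cut_connected A -> cut_connected B ->
  a \in A -> a \in B -> cut_connected (A :|: B).
Proof.
move=> cA cB aA aB.
have := @cut_connected_bigcup _ predT (fun b : bool => if b then A else B) a.
by rewrite big_bool /=; apply; case.
Qed.

Lemma cut_connectedU1 A x y : symmetric adj -> cut_connected A ->
  x \in A -> adj x y -> cut_connected (y |: A).
Proof.
move=> sym cA xA xy; have -> : y |: A = A :|: [set x; y].
  by apply/setP => z; rewrite !inE; case: (z =P x) => [->|] //=; rewrite ?xA ?orbT // orbC.
by apply: (@cut_connectedU _ _ x) => //; [exact: cut_connected2|rewrite !inE eqxx].
Qed.

End CutConnected.

(* Merging along one pair lowers the number of classes by at most one. *)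
Lemma merge_classes (V : finType) (D : {set {set V}}) :
  (forall s, s \in D -> #|s| = 2) ->
  exists c : V -> V, (forall s, s \in D -> {in s &, forall x y, c x = c y}) /\
    forall A : {set V}, #|A| <= #|c @: A| + #|D|.
Proof.
move=> D2.
suff H (l : seq {set V}) : {subset l <= D} ->
    exists c : V -> V, (forall s, s \in l -> {in s &, forall x y, c x = c y}) /\
    forall A : {set V}, #|A| <= #|c @: A| + size l.
  have [|c [c1 c2]] := H (enum D); first by move=> s; rewrite mem_enum.
  by exists c; split=> [s sD|A]; [apply: c1; rewrite mem_enum|rewrite [#|D|]cardE; exact: c2].
elim: l => [_|s l IHl sl].
  by exists id; split=> // A; rewrite imset_id addn0.
have [|c [c1 c2]] := IHl; first by move=> t tl; apply: sl; rewrite inE tl orbT.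
have /eqP/cards2P[a [b [ab es]]] := D2 s (sl s (mem_head _ _)).
pose h y := if y == c b then c a else y.
exists (h \o c); split=> [t|A].
  rewrite inE => /predU1P[-> x y|/c1 tl x y xt yt]; last by rewrite /= (tl x y).
  rewrite es !inE /h /= => /orP[]/eqP-> /orP[]/eqP->; rewrite ?eqxx //.
    by case: eqP.
  by case: eqP.
apply: leq_trans (c2 A) _; rewrite (imset_comp h c) addnS -addSn leq_add2r.
have : (c @: A) :\ c b \subset h @: (c @: A).
  apply/subsetP => y /setD1P[yb yA]; apply/imsetP; exists y => //.
  by rewrite /h (negPf yb).
move/subset_leq_card; move: (cardsD1 (c b) (c @: A)); case: (_ \in _) => /= ->; lia.
Qed.

(** * Parity of cuts in a triangulated pseudosurface *)

Section Surface.
Variables (V : finType) (F : {set {set V}}).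
Implicit Types (s t : {set V}) (U : {set V}) (Phi : {set {set V}}).

Definition sides : {set {set V}} :=
  [set s : {set V} | (#|s| == 2) && [exists t : {set V} in F, s \subset t]].
Definition side_adj : rel V := fun x y => [set x; y] \in sides.
Definition cofaces s : {set {set V}} := [set t : {set V} in F | s \subset t].

(** Vertex links may be disconnected, so pinched vertices are allowed. The last clause is
    connectivity of the dual graph, again in cut form. *)
Definition closed_pseudosurface :=
  [/\ forall t : {set V}, t \in F -> #|t| = 3,
      forall s : {set V}, s \in sides -> #|cofaces s| = 2 &
      forall Phi, Phi \subset F -> Phi != set0 ->
        (forall s t t' : {set V}, s \in sides -> t \in cofaces s -> t' \in cofaces s ->
           t \in Phi -> t' \in Phi) -> Phi = F].

Lemma side_adj_sym : symmetric side_adj.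
Proof. by move=> x y; rewrite /side_adj setUC. Qed.

Lemma side_adjP x y :
  reflect (x != y /\ exists2 t : {set V}, t \in F & (x \in t) && (y \in t)) (side_adj x y).
Proof.
rewrite /side_adj inE cards2; apply: (iffP andP) => [[xy /exists_inP[t tF st]]|].
  split; first by move: xy; case: (x != y).
  by exists t => //; move: st; rewrite subUset !sub1set.
move=> [xy [t tF xyt]]; rewrite xy; split=> //; apply/exists_inP; exists t => //.
by rewrite subUset !sub1set.
Qed.

Hypothesis F3 : forall t : {set V}, t \in F -> #|t| = 3.

Definition crosses s U := #|s :&: U| == 1.

(** A triangle meeting [U] in one or two vertices has two sides across the cut, otherwise none.
    Sides are indexed by their opposite vertex. *)
Lemma even_cut_triangle U t : t \in F ->
  ~~ odd #|[set s : {set V} in sides | crosses s U & s \subset t]|.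
Proof.
move=> tF; have t3 := F3 tF.
set k := #|t :&: U|.
have kD : #|t :\: U| = 3 - k by rewrite -t3 -(cardsID U t) addKn.
have k3 : k <= 3 by rewrite -t3 subset_leq_card ?subsetIl.
pose X := [set x in t | k - (x \in U) == 1].
have -> : [set s : {set V} in sides | crosses s U & s \subset t] = (fun x => t :\ x) @: X.
  apply/setP => s; apply/idP/imsetP.
    rewrite !inE => /and3P[/andP[s2 _] cr st].
    have : #|t :\: s| == 1.
      by rewrite -(eqn_add2l #|t :&: s|) cardsID t3 (setIidPr st) (eqP s2).
    move=> /cards1P[x ex].
    have es : s = t :\ x by rewrite -ex setDDr setDv set0U (setIidPr st).
    have xt : x \in t by have /setDP[] : x \in t :\: s by rewrite ex set11.
    exists x => //; rewrite inE xt /=; move: cr; rewrite es /crosses setIDAC.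
    by rewrite /k (cardsD1 x (t :&: U)) inE xt /= addKn.
  move=> [x /setIdP[xt kx] ->].
  have c2 : #|t :\ x| = 2 by move: t3; rewrite (cardsD1 x t) xt => -[].
  rewrite !inE c2 eqxx subsetDl /=; apply/andP; split; last rewrite andbT.
    by apply/exists_inP; exists t => //; exact: subsetDl.
  by move: kx; rewrite /crosses setIDAC /k (cardsD1 x (t :&: U)) inE xt /= addKn.
rewrite card_in_imset; last first.
  move=> x y /setIdP[xt _] /setIdP[yt _] /setP/(_ x).
  by rewrite !in_setD1 eqxx xt andbT; case: eqP.
have [ek|[ek|[ek|ek]]] : k = 0 \/ k = 1 \/ k = 2 \/ k = 3 by lia.
- by rewrite (_ : X = set0) ?cards0 //; apply/setP => x; rewrite !inE ek andbF.
- rewrite (_ : X = t :\: U) ?kD ?ek //; apply/setP => x; rewrite !inE ek.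
  by case: (x \in U); rewrite /= ?andbF ?andbT.
- rewrite (_ : X = t :&: U) -?/k ?ek //; apply/setP => x; rewrite !inE ek.
  by case: (x \in U); rewrite /= ?andbF ?andbT.
- rewrite (_ : X = set0) ?cards0 //; apply/setP => x; rewrite !inE ek.
  by case: (x \in U); rewrite /= ?andbF.
Qed.

(** The boundary modulo 2 of a set of triangles is a cycle, so it meets every vertex cut evenly. *)
Lemma even_cut U Phi : Phi \subset F ->
  ~~ odd (\sum_(s in sides | crosses s U) #|[set t : {set V} in Phi | s \subset t]|).
Proof.
move=> PF.
under eq_bigr do rewrite -sum1_card.
rewrite (exchange_big_dep (mem Phi)) /=; last by move=> s t _; rewrite inE => /andP[].
elim/big_rec : _ => // t n tP en; rewrite oddD (negPf en) addbF.
have := even_cut_triangle U (subsetP PF t _); rewrite -sum1_card => H.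
rewrite (eq_bigl (mem [set s : {set V} in sides | crosses s U & s \subset t])) ?H //.
by move=> s; rewrite !inE tP /= !andbA.
Qed.

Lemma crossesP s U : #|s| = 2 ->
  reflect (exists u v, [/\ s = [set u; v], u \in U & v \notin U]) (crosses s U).
Proof.
move=> s2; apply: (iffP idP) => [cr|[u [v [-> uU vU]]]]; last first.
  apply/cards1P; exists u; apply/setP => z; rewrite !inE.
  by case: eqP => [->|_]; [rewrite uU|case: eqP => // ->; rewrite (negPf vU)].
have := cardsID U s; rewrite s2 (eqP cr) => -[/eqP/cards1P[v ev]].
have /cards1P[u eu] := cr; exists u, v; split.
- by rewrite -(setID s U) eu ev.
- by have /setIP[] : u \in s :&: U by rewrite eu set11.
- by have /setDP[] : v \in s :\: U by rewrite ev set11.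
Qed.

End Surface.

Lemma leq_card_imset_factor (A B C : finType) (f : A -> B) (h : A -> C) (X : {set A}) :
  {in X &, forall x y, f x = f y -> h x = h y} -> #|h @: X| <= #|f @: X|.
Proof.
move=> fh; have [->|[x0 _]] := set_0Vmem X; first by rewrite !imset0 !cards0.
pose k b := h (odflt x0 [pick x in X | f x == b]).
suff -> : h @: X = k @: (f @: X) by exact: leq_imset_card.
rewrite -imset_comp; apply: eq_in_imset => x xX; rewrite /= /k.
by case: pickP => [y /andP[yX /eqP e]|/(_ x)]; [rewrite /= (fh y x)|rewrite xX eqxx].
Qed.

Lemma odd_sum_exists (A : finType) (P : pred A) (f : A -> nat) :
  odd (\sum_(i | P i) f i) -> exists2 i, P i & odd (f i).
Proof.
move=> o; suff /existsP[i /andP[]] : [exists i, P i && odd (f i)] by exists i.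
apply: contraLR o => /existsPn H; elim/big_rec : _ => // i n Pi en.
by rewrite oddD (negPf en) addbF; move: (H i); rewrite Pi.
Qed.

(** * Euler's inequality for a contracted pseudosurface *)

Section Euler.
Variables (V : finType) (F : {set {set V}}) (I : finType) (b : V -> I).
Hypothesis F3 : forall t : {set V}, t \in F -> #|t| = 3.
Hypothesis F2 : forall s : {set V}, s \in sides F -> #|cofaces F s| = 2.
Hypothesis Fconn : forall Phi : {set {set V}}, Phi \subset F -> Phi != set0 ->
  (forall s t t' : {set V}, s \in sides F -> t \in cofaces F s ->
     t' \in cofaces F s -> t \in Phi -> t' \in Phi) -> Phi = F.

Hypothesis fibers_connected :
  forall i, cut_connected (side_adj F) [set x in cover F | b x == i].

Let E := sides F.
Let side2 (s : {set V}) : s \in E -> #|s| = 2. Proof. by rewrite inE => /andP[/eqP]. Qed.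

(** [T] connects each fiber of [b]. Stated through cuts, a minimal such [T] serves as a spanning
    forest without any mention of cycles. *)
Definition links (T : {set {set V}}) :=
  [forall S : {set V}, forall x in cover F, forall y in cover F,
    [&& b x == b y, x \in S & y \notin S] ==> [exists s : {set V} in T, crosses s S]].

Lemma linksP (T : {set {set V}}) : reflect (forall (S : {set V}) x y, x \in cover F -> y \in cover F ->
    b x = b y -> x \in S -> y \notin S -> exists2 s : {set V}, s \in T & crosses s S) (links T).
Proof.
apply: (iffP forallP) => [H S x y xF yF bxy xS yS|H S].
  have /forall_inP/(_ x xF)/forall_inP/(_ y yF) := H S.
  by rewrite bxy eqxx xS yS => /exists_inP.
apply/forall_inP => x xF; apply/forall_inP => y yF.
by apply/implyP => /and3P[/eqP bxy xS yS]; apply/exists_inP; exact: (H S x y).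
Qed.

Let inner := [set s : {set V} in E | #|b @: s| == 1].

Lemma inner_const (s : {set V}) u v : s \in inner -> u \in s -> v \in s -> b u = b v.
Proof.
move=> /setIdP[_ /cards1P[i ei]] us vs.
have := imset_f b us; have := imset_f b vs; rewrite ei !inE.
by move=> /eqP-> /eqP->.
Qed.

Lemma links_inner : links inner.
Proof.
apply/linksP => S x y xF yF bxy xS yS.
have [||u [v [/setIP[/setIdP[uF bu] uS] /setDP[/setIdP[vF bv] vS] uv]]] :=
  @fibers_connected (b x) S.
- by exists x => //; rewrite inE xF eqxx.
- by apply/subsetPn; exists y => //; rewrite inE yF bxy eqxx.
exists [set u; v]; last by apply/crossesP; [exact: side2|exists u, v].
rewrite inE; apply/andP; split; first exact: uv.
by rewrite imsetU1 imset_set1 (eqP bu) (eqP bv) setUid cards1.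
Qed.

(** In an inclusion-minimal linking set, dropping [t] leaves some cut of a fiber uncrossed, so [t]
    alone crosses it: the fundamental cut of a tree edge. *)
Lemma bridges : exists2 T : {set {set V}}, T \subset inner & links T /\
  forall t : {set V}, t \in T -> exists2 U, crosses t U & forall s : {set V}, s \in T -> crosses s U -> s = t.
Proof.
have [T /minsetP[lT minT] Tin] := minset_exists links_inner.
exists T => //; split=> // t tT.
have : ~~ links (T :\ t).
  by apply/negP => /minT/(_ (subsetDl _ _))/setP/(_ t); rewrite !inE eqxx tT.
case/forallPn => U /forall_inPn[x xF /forall_inPn[y yF]].
rewrite negb_imply => /andP[/and3P[/eqP bxy xU yU] /exists_inPn H].
have only s : s \in T -> crosses s U -> s = t.
  move=> sT cs; apply/eqP; apply: contraLR cs => st; apply: H.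
  by rewrite !inE st.
have /linksP/(_ U x y xF yF bxy xU yU)[s sT cs] := lT.
by exists U => //; rewrite -(only s).
Qed.

(** After merging along [T] every fiber is one class, since a class is a cut that no member of [T]
    crosses. *)
Lemma card_bridges (T : {set {set V}}) : T \subset inner -> links T ->
  #|cover F| <= #|b @: cover F| + #|T|.
Proof.
move=> Tin /linksP lT.
have T2 s : s \in T -> #|s| = 2 by move=> /(subsetP Tin)/setIdP[/side2].
have [c [c1 c2]] := merge_classes T2.
apply: leq_trans (c2 (cover F)) _; rewrite leq_add2r.
apply: leq_card_imset_factor => x y xF yF bxy; apply/eqP/negPn/negP => cxy.
have [s sT] : exists2 s : {set V}, s \in T & crosses s [set z | c z == c x].
  by apply: (lT _ x y) => //; rewrite inE // eq_sym.
case/(crossesP _ (T2 s sT)) => u [v [es]]; rewrite !inE => /eqP cu /negP; apply.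
by rewrite (c1 s sT v u) ?cu // es !inE eqxx ?orbT.
Qed.

Definition adjacent_blocks : {set {set I}} :=
  [set p : {set I} in (fun s : {set V} => b @: s) @: E | #|p| == 2].
Let M := adjacent_blocks.
Let rep (p : {set I}) : {set V} := odflt set0 [pick s : {set V} in E | b @: s == p].

Let repP p : p \in M -> rep p \in E /\ b @: rep p = p.
Proof.
move=> /setIdP[/imsetP[s sE ->] _]; rewrite /rep.
by case: pickP => [s' /andP[s'E /eqP]|/(_ s)] //; rewrite sE eqxx.
Qed.

(** One representative per adjacent pair of blocks: parallel edges of the contraction are reduced to
    a single kept side. *)
Let R := rep @: M.

Let repK (r : {set V}) : r \in R -> [/\ r \in E, b @: r \in M & rep (b @: r) = r].
Proof. by move=> /imsetP[p pM ->]; have [? e] := repP pM; split; rewrite ?e. Qed.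

Let inj_R (r r' : {set V}) : r \in R -> r' \in R -> b @: r = b @: r' -> r = r'.
Proof. by move=> /repK[_ _ e] /repK[_ _ e'] h; rewrite -e h. Qed.

Let cardR : #|R| = #|M|.
Proof.
apply: card_in_imset => p q pM qM e.
by rewrite -(repP pM).2 e (repP qM).2.
Qed.

Let degree (Phi : {set {set V}}) (s : {set V}) := #|[set t : {set V} in Phi | s \subset t]|.

(* A dual class is a face of the contracted graph; a simple graph has no faces
   of length one or two. *)
Lemma face_length (T Phi : {set {set V}}) : T \subset inner ->
  (forall t : {set V}, t \in T -> exists2 U, crosses t U & forall s : {set V}, s \in T -> crosses s U -> s = t) ->
  Phi \subset F -> Phi != set0 ->
  (forall s : {set V}, s \in E -> s \notin T -> s \notin R -> ~~ odd (degree Phi s)) ->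
  1 < #|M| -> 2 < \sum_(r in R) degree Phi r.
Proof.
move=> Tin br PF Pn0 Dev M2; rewrite ltnNge; apply/negP => small.
have nocross (s : {set V}) i : s \in T -> ~~ crosses s [set x | b x == i].
  move=> /(subsetP Tin) si; have /setIdP[sE _] := si.
  apply/negP => /(crossesP _ (side2 sE))[u [v [es]]].
  rewrite !inE => /eqP ui /negP; apply.
  by rewrite (@inner_const s v u) ?ui // es !inE eqxx ?orbT.
(* An odd edge [r] between blocks [i] and [j] forces, through the cuts around [i] and around [j],
   two further odd edges. They are distinct because [r] is the only kept edge joining [i] and [j],
   and three odd edges exceed length two. *)
have Rev (r : {set V}) : r \in R -> ~~ odd (degree Phi r).
  move=> rR; apply/negP => odr.
  have [rE rM _] := repK rR.
  have other i : i \in b @: r -> exists s : {set V}, [/\ s \in R, s != r, i \in b @: s & odd (degree Phi s)].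
    move=> ir; pose U := [set x | b x == i].
    have cr : crosses r U.
      have /setIdP[_ br2] := rM.
      move/imsetP: ir => [x xr ex]; apply/crossesP; first exact: side2.
      have /cards2P[u [v [uv er]]] : #|r| == 2 by rewrite side2.
      have buv : b u != b v.
        by move: br2; rewrite er imsetU1 imset_set1 cards2; case: (_ != _).
      move: xr; rewrite {1}er !inE => /orP[]/eqP exx; subst x.
        by exists u, v; rewrite !inE ex eqxx eq_sym buv.
      by exists v, u; rewrite !inE ex eqxx buv setUC.
    have := even_cut F3 U PF; rewrite (bigD1 r) /=; last by rewrite rE.
    rewrite oddD -[X in odd X](_ : degree Phi r = _) // odr addTb negbK.
    move=> /odd_sum_exists[s /andP[/andP[sE cs] sr] os].
    have sT : s \notin T by apply: contraL cs; exact: nocross.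
    have sR : s \in R by apply: contraLR os => sR; exact: Dev.
    exists s; split=> //.
    have /(crossesP _ (side2 sE))[u [v [-> ]]] := cs.
    by rewrite !inE => /eqP <- _; rewrite imset_f // !inE eqxx.
  have /setIdP[_ /cards2P[i [j [ij er]]]] := rM.
  have [|s [sR sr si os]] := other i; first by rewrite er !inE eqxx.
  have [|s' [s'R s'r s'j os']] := other j; first by rewrite er !inE eqxx orbT.
  have [ss|ss] := eqVneq s s'.
    subst s'; move/eqP: sr; apply; apply: inj_R => //; rewrite er.
    apply/esym/eqP; rewrite eqEcard subUset !sub1set si s'j cards2 ij /=.
    by have [_ /setIdP[_ /eqP->] _] := repK sR.
  move: small; rewrite (bigD1 r) //= (bigD1 s) /=; last exact/andP.
  rewrite (bigD1 s') /=; last by rewrite s'R s'r eq_sym.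
  have aux : forall k l m n, odd k -> odd l -> odd m -> k + (l + (m + n)) <= 2 -> False.
    by clear; lia.
  exact: (aux _ _ _ _ odr os os').
(* Tree edges are even too: every other side across the fundamental cut of [s] is even. *)
have ev (s : {set V}) : s \in E -> ~~ odd (degree Phi s).
  move=> sE; have [sT|sT] := boolP (s \in T); last first.
    have [/Rev //|sR] := boolP (s \in R).
    exact: Dev.
  have [U cs onlyU] := br s sT; apply/negP => os.
  have := even_cut F3 U PF; rewrite (bigD1 s) /=; last by rewrite sE.
  rewrite oddD -[X in odd X](_ : degree Phi s = _) // os addTb negbK.
  move=> /odd_sum_exists[s' /andP[/andP[s'E cs'] ss'] os'].
  have [s'T|s'T] := boolP (s' \in T).
    by move/eqP: ss'; apply; exact: onlyU.
  have [/Rev|s'R] := boolP (s' \in R); first by rewrite os'.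
  by have := Dev s' s'E s'T s'R; rewrite os'.
(* Even degree now means both triangles at a side or neither, so [Phi] is closed across sides. Every
   kept edge then counts twice, and there are at least two of them. *)
have ePhi : Phi = F.
  apply: Fconn => // s t t' sE tc t'c tP.
  have sub : [set u : {set V} in Phi | s \subset u] \subset cofaces F s.
    by apply/subsetP => u /setIdP[/(subsetP PF) uF su]; rewrite inE uF.
  have := ev s sE; have := subset_leq_card sub; rewrite F2 // -/(degree Phi s).
  have : 0 < degree Phi s.
    by rewrite card_gt0; apply/set0Pn; exists t; rewrite inE tP; move: tc => /setIdP[].
  case ed: (degree Phi s) => [|[|[|]]] // _ _ _.
  move/eqP: sub; have /eqP := ed; rewrite /degree -(F2 sE) => /eqP ed' _.
  have /setP/(_ t') : [set u : {set V} in Phi | s \subset u] = cofaces F s.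
    apply/eqP; rewrite eqEcard ed' leqnn andbT.
    by apply/subsetP => u /setIdP[/(subsetP PF) uF su]; rewrite inE uF.
  by rewrite t'c inE => /andP[].
move: small; rewrite ePhi (eq_bigr (fun=> 2)); last by move=> r /repK[/F2].
by rewrite sum_nat_const cardR; lia.
Qed.

(** With [t] tree sides, [m] kept and [d] deleted ones, merging loses at most [t] vertices and [d]
    faces, and three times the remaining faces is at most [2 * m]. The left disjunct covers
    contractions whose only face is shorter than three. *)
Lemma euler_spanning : #|M| <= 1 \/
  3 * #|F| + 3 * #|cover F| + #|M| <= 3 * #|b @: cover F| + 3 * #|E|.
Proof.
have [M2|] := ltnP 1 #|M|; [right|by left].
have [T Tin [lT br]] := bridges.
pose D := E :\: (T :|: R).
have TE : T \subset E by apply: subset_trans Tin _; apply/subsetP => s /setIdP[].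
have RE : R \subset E by apply/subsetP => r /repK[].
have TR : [disjoint T & R].
  rewrite -setI_eq0; apply/eqP/setP => s; rewrite !inE; apply/negP => /andP[sT sR].
  have [_ /setIdP[_ b2] _] := repK sR.
  by have /setIdP[_] := subsetP Tin _ sT; rewrite (eqP b2).
have cE : #|E| = #|T| + #|R| + #|D|.
  have := cardsID (T :|: R) E; rewrite -/D (setIidPr _) ?subUset ?TE //.
  by have := (leq_card_setU T R).2; rewrite TR => /eqP->.
have D2 (p : {set {set V}}) : p \in cofaces F @: D -> #|p| = 2.
  by move=> /imsetP[s /setDP[sE _] ->]; exact: F2.
have [k [k1 k2]] := merge_classes D2.
have cF := k2 F; have cD := leq_imset_card (cofaces F) D.
have cV := card_bridges Tin lT.
pose Phi f := [set t : {set V} in F | k t == f].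
have dbl : \sum_(f in k @: F) \sum_(r in R) degree (Phi f) r = 2 * #|R|.
  rewrite exchange_big /= mulnC -sum_nat_const; apply: eq_bigr => r /repK[rE _ _].
  rewrite -(F2 rE) -sum1_card [RHS](partition_big k (mem (k @: F))) /=; last first.
    by move=> t; rewrite inE => /andP[tF _]; exact: imset_f.
  apply: eq_bigr => f _; rewrite /degree -sum1_card; apply: eq_bigl => t.
  by rewrite !inE -!andbA; congr (_ && _); exact: andbC.
have : 3 * #|k @: F| <= 2 * #|R|.
  rewrite -dbl mulnC -sum_nat_const; apply: leq_sum => f /imsetP[t tF ef].
  apply: (face_length Tin br) => //.
  - by apply/subsetP => u /setIdP[].
  - by apply/set0Pn; exists t; rewrite inE tF ef eqxx.
  (* Both triangles at a deleted side are merged, so a class contains both or none of them. *)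
  - move=> s sE sT sR; have sD : s \in D by rewrite in_setD in_setU negb_or sT sR.
    have ks := k1 _ (imset_f (cofaces F) sD).
    have [e|[u /setIdP[/setIdP[uF uf] su]]] :=
      set_0Vmem [set t : {set V} in Phi f | s \subset t].
      by rewrite /degree e cards0.
    rewrite /degree (_ : [set _ in _ | _] = cofaces F s) ?F2 //.
    apply/setP => v; rewrite !inE; have [vF|] //= := boolP (v \in F).
    have [sv|] := boolP (s \subset v); last by rewrite andbF.
    by rewrite andbT (ks v u) // inE ?vF ?uF.
have aux : forall f v n e m t d f' d', f <= f' + d' -> d' <= d -> v <= n + t ->
  e = t + m + d -> 3 * f' <= 2 * m -> 3 * f + 3 * v + m <= 3 * n + 3 * e by clear; lia.
by rewrite -cardR; exact: aux cF cD cV cE.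
Qed.

End Euler.

(** * Branch sets and minors *)

Section Blocks.
Variables (V I : finType) (adj : rel V).
Implicit Types B : I -> {set V}.

Definition disjoint_blocks B := forall i j x, x \in B i -> x \in B j -> i = j.

Definition touching B : {set {set I}} :=
  [set p : {set I} | [exists i, exists j, [&& p == [set i; j], i != j &
     [exists x in B i, exists y in B j, adj x y]]]].

Lemma touchingP B (p : {set I}) : reflect
  (exists i j x y, [/\ p = [set i; j], i != j, x \in B i, y \in B j & adj x y])
  (p \in touching B).
Proof.
rewrite inE; apply: (iffP existsP) => [[i /existsP[j /and3P[/eqP pij ij]]]|].
  by case/exists_inP => x xi /exists_inP[y yj xy]; exists i, j, x, y.
move=> [i [j [x [y [-> ij xi yj xy]]]]]; exists i; apply/existsP; exists j.
rewrite eqxx ij; apply/exists_inP; exists x => //.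
by apply/exists_inP; exists y.
Qed.

End Blocks.

(* The blocks B i are branch sets: touching B lists the edges of the simple minor
   obtained by contracting them. *)
Definition minor_sparse (V : finType) (adj : rel V) g :=
  forall (I : finType) (B : I -> {set V}),
    (forall i, cut_connected adj (B i)) -> disjoint_blocks B ->
    #|touching adj B| <= 3 * #|[set i | B i != set0]| + 3 * g.

Section SurfaceMinors.
Variables (V : finType) (F : {set {set V}}).
Hypothesis surfF : closed_pseudosurface F.

(** If no side leaves [S], the triangles contained in [S] are closed across sides, hence are all of
    [F]. *)
Lemma surface_connected : cut_connected (side_adj F) (cover F).
Proof.
case: surfF => F3 F2 Fc S [x /bigcupP[t tF xt] xS] nS.
have [/existsP[u /existsP[v /and3P[uS vS uv]]]|nex] := boolP
    [exists u, exists v, [&& u \in S, v \in cover F :\: S & side_adj F u v]].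
  exists u, v; split=> //; rewrite inE uS andbT; move: uv => /side_adjP[_ [t' t'F /andP[ut _]]].
  by apply/bigcupP; exists t'.
have closed (t' : {set V}) u v : t' \in F -> u \in t' -> v \in t' -> u \in S -> v \in S.
  move=> t'F ut vt uS; apply/negPn/negP => vS; case/existsP: nex.
  exists u; apply/existsP; exists v; rewrite uS inE vS; apply/and3P; split=> //.
    by apply/bigcupP; exists t'.
  apply/side_adjP; split; first by apply: contraNneq vS => <-.
  by exists t'; rewrite ?ut.
have eF : [set t : {set V} in F | t \subset S] = F.
  apply: Fc.
  - by apply/subsetP => u /setIdP[].
  - apply/set0Pn; exists t; rewrite inE tF; apply/subsetP => y yt.
    exact: (closed t x y).
  - move=> s u v sE; rewrite !inE => /andP[uF su] /andP[vF sv] /andP[_ uS].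
    rewrite vF; apply/subsetP => y yv.
    have /card_gt0P[z zs] : 0 < #|s| by move: sE; rewrite inE => /andP[/eqP->].
    apply: (closed v z y) => //; first exact: (subsetP sv).
    exact/(subsetP uS)/(subsetP su).
case/negP: nS; apply/bigcupsP => u; rewrite -{1}eF.
by rewrite inE => /andP[].
Qed.

(** [euler_spanning] needs a label on every vertex. Connectivity provides an uncovered vertex next
    to some block, which absorbs it; empty blocks stay empty, so the minor gains no vertex. *)
Lemma extend_blocks (I : finType) (B : I -> {set V}) i0 :
  (forall i, B i \subset cover F) -> (forall i, cut_connected (side_adj F) (B i)) ->
  disjoint_blocks B -> B i0 != set0 ->
  exists b : V -> I, [/\ forall i x, x \in B i -> b x = i,
    forall i, cut_connected (side_adj F) [set x in cover F | b x == i] &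
    forall x, x \in cover F -> B (b x) != set0].
Proof.
move: {2}#|_| (leqnn #|cover F :\: \bigcup_i B i|) => n.
elim: n B => [|n IHn] B; last first.
  move=> cn Bsub Bc Bd B0.
  have [/set0Pn|] := boolP (cover F :\: \bigcup_i B i != set0); last first.
    by rewrite negbK -cards_eq0 => /eqP e; apply: (IHn B) => //; rewrite e.
  move=> [z /setDP[zF zB]].
  have [||x [y [/setIP[_ /bigcupP[i _ xi]] /setDP[yF yB] xy]]] :=
    @surface_connected (\bigcup_i B i).
  - case/set0Pn: B0 => x x0; exists x; first exact: (subsetP (Bsub i0)).
    by apply/bigcupP; exists i0.
  - by apply/subsetPn; exists z.
  pose B' j := if j == i then y |: B i else B j.
  have BB' j : B j \subset B' j.
    by rewrite /B'; case: eqP => [->|//]; exact: subsetUr.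
  have B'x j w : w \in B' j -> w \in B j \/ (w = y /\ j = i).
    rewrite /B'; case: eqP => [->|_]; last by left.
    by rewrite !inE => /orP[/eqP->|]; [right|left].
  have yN j : y \notin B j by apply: contra yB => yj; apply/bigcupP; exists j.
  have [||||| b [b1 b2 b3]] := IHn B'.
  - rewrite -ltnS; apply: leq_trans cn; apply/proper_card/properP; split.
      apply: setDS; apply/bigcupsP => j _; apply: subset_trans (BB' j) _.
      exact: bigcup_sup.
    exists y; first by rewrite inE yB.
    rewrite inE negb_and negbK; apply/orP; left; apply/bigcupP; exists i => //.
    by rewrite /B' eqxx !inE eqxx.
  - by move=> j; apply/subsetP => w /B'x[/(subsetP (Bsub j))|[-> _]].
  - move=> j; rewrite /B'; case: eqP => [_|//].
    by apply: cut_connectedU1 xy => //; exact: side_adj_sym.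
  - move=> j k w /B'x[wj|[-> ->]] /B'x[wk|[wy ->]] //; first exact: Bd wj wk.
      by move: wj; rewrite wy (negPf (yN j)).
    by move: wk; rewrite (negPf (yN k)).
  - by apply: contraNneq B0 => e; rewrite -subset0 -e.
  exists b; split=> // [j w wj|w wF]; first exact/b1/(subsetP (BB' j)).
  case/set0Pn: (b3 w wF) => v /B'x[vb|[_ ->]]; apply/set0Pn; first by exists v.
  by exists x.
rewrite leqn0 cards_eq0 setD_eq0 => /subsetP cov Bsub Bc Bd B0.
pose b x := odflt i0 [pick i | x \in B i].
have bB i x : x \in B i -> b x = i.
  by move=> xi; rewrite /b; case: pickP => [j /Bd/(_ xi)|/(_ i)]; rewrite ?xi.
have inb x : x \in cover F -> x \in B (b x).
  by move=> /cov/bigcupP[i _ xi]; rewrite (bB i).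
exists b; split=> // [i|x /inb xb]; last by apply/set0Pn; exists x.
suff -> : [set x in cover F | b x == i] = B i by [].
apply/setP => x; rewrite inE; apply/andP/idP => [[/inb xb /eqP<-]|xi] //.
by rewrite (subsetP (Bsub i)) // (bB i x xi) eqxx.
Qed.

(** The second hypothesis bounds 2 minus the Euler characteristic by [g]; positivity of [g] pays for
    the case of at most one edge. *)
Lemma surface_minor_bound g (I : finType) (B : I -> {set V}) :
  0 < g -> #|sides F| + 2 <= #|cover F| + #|F| + g ->
  (forall i, B i \subset cover F) -> (forall i, cut_connected (side_adj F) (B i)) ->
  disjoint_blocks B ->
  #|touching (side_adj F) B| <= 3 * #|[set i | B i != set0]| + 3 * g.
Proof.
move=> g0 chi Bsub Bc Bd.
have [/existsP[i0 Bi0]|none] := boolP [exists i, B i != set0]; last first.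
  rewrite (_ : touching _ _ = set0) ?cards0 //; apply/setP => p; rewrite [RHS]inE.
  apply/negP => /touchingP[i [j [x [y [_ _ xi _ _]]]]]; case/existsP: none.
  by exists i; apply/set0Pn; exists x.
have [b [b1 b2 b3]] := extend_blocks Bsub Bc Bd Bi0.
have [F3 F2 Fc] := surfF.
have tM : #|touching (side_adj F) B| <= #|adjacent_blocks F b|.
  apply/subset_leq_card/subsetP => p /touchingP[i [j [x [y [-> ij xi yj xy]]]]].
  rewrite inE cards2 ij andbT; apply/imsetP; exists [set x; y]; first exact: xy.
  by rewrite imsetU1 imset_set1 (b1 i x) // (b1 j y).
have cb : #|b @: cover F| <= #|[set i | B i != set0]|.
  by apply/subset_leq_card/subsetP => _ /imsetP[x xF ->]; rewrite inE b3.
have := euler_spanning F3 F2 Fc b2; move: tM cb chi g0; clear; lia.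
Qed.

End SurfaceMinors.

(** A minor of a minor is a minor. A cut of a union of models [A u] either splits one model, or
    separates whole models and so is crossed by an edge between two of them. *)
Lemma minor_sparse_model (V : finType) (adj : rel V) (T : finType) (e : rel T)
    (P : pred V) (A : T -> {set V}) g :
  (forall (I : finType) (B : I -> {set V}), (forall i, B i \subset P) ->
    (forall i, cut_connected adj (B i)) -> disjoint_blocks B ->
    #|touching adj B| <= 3 * #|[set i | B i != set0]| + 3 * g) ->
  (forall u, A u \subset P) -> (forall u, cut_connected adj (A u)) ->
  (forall u, A u != set0) -> disjoint_blocks A ->
  (forall u v, e u v -> exists x y, [/\ x \in A u, y \in A v & adj x y]) ->
  minor_sparse e g.
Proof.
move=> sp AP Ac A0 Ad Ae I B Bc Bd.
pose B' i := \bigcup_(u in B i) A u.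
have B'0 : [set i | B i != set0] = [set i | B' i != set0].
  apply/setP => i; rewrite !inE; apply/set0Pn/set0Pn => [[u ui]|[x /bigcupP[u ui _]]].
    by case/set0Pn: (A0 u) => x xu; exists x; apply/bigcupP; exists u.
  by exists u.
rewrite B'0; apply: leq_trans (sp _ B' _ _ _).
- apply/subset_leq_card/subsetP => p /touchingP[i [j [u [v [-> ij ui vj uv]]]]].
  have [x [y [xu yv xy]]] := Ae u v uv.
  by apply/touchingP; exists i, j, x, y; split=> //; apply/bigcupP; [exists u|exists v].
- by move=> i; apply/bigcupsP.
- move=> i S [x /bigcupP[u ui xu] xS] /subsetPn[y /bigcupP[w wi yw] yS].
  have [/exists_inP[z zi /andP[/set0Pn[x' /setIP[x'z x'S]] nz]]|nsp] :=
      boolP [exists z in B i, (A z :&: S != set0) && ~~ (A z \subset S)].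
    have [|p [q [/setIP[pz pS] /setDP[qz qS] pq]]] := Ac z S _ nz; first by exists x'.
    by exists p, q; split=> //; rewrite !inE ?pS ?qS ?andbT /=; apply/bigcupP; exists z.
  have dich z p : z \in B i -> p \in A z -> p \in S -> A z \subset S.
    move=> zi pz pS; apply/negPn/negP => nz; case/exists_inP: nsp; exists z => //.
    by rewrite nz andbT; apply/set0Pn; exists p; rewrite inE pz.
  have [||z [z' [/setIP[zi] + /setDP[z'i] + zz']]] := Bc i [set z | A z \subset S].
  - by exists u => //; rewrite inE (dich u x).
  - apply/subsetPn; exists w => //; rewrite inE; apply: contra yS => /subsetP; exact.
  rewrite !inE => zS z'S; have [p [q [pz qz pq]]] := Ae z z' zz'.
  exists p, q; rewrite !inE (subsetP zS p pz) andbT; split=> //.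
    by apply/bigcupP; exists z.
  apply/andP; split; last by apply/bigcupP; exists z'.
  by apply: contra z'S; exact: dich.
- move=> i j x /bigcupP[u ui xu] /bigcupP[v vj xv].
  by move: vj; rewrite -(Ad _ _ _ xu xv); exact: Bd ui.
Qed.

(* Vertices and edges may both be thickened to overlapping connected pieces:
   the part of an edge piece reached before the other end is absorbed into the
   block of its first endpoint. *)
Lemma minor_model_of_pieces (V : finType) (adj : rel V) (T : finType) (e : rel T)
    (A : T -> {set V}) (C : T -> T -> {set V}) (P : pred V) :
  symmetric adj -> symmetric e -> irreflexive e ->
  (forall u, A u \subset P) -> (forall u, cut_connected adj (A u)) ->
  (forall u, A u != set0) -> disjoint_blocks A ->
  (forall u v, e u v -> [/\ cut_connected adj (C u v), C u v \subset P,
     A u :&: C u v != set0 & A v :&: C u v != set0]) ->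
  (forall u v w x, e u v -> x \in C u v -> x \in A w -> w = u \/ w = v) ->
  (forall u v u' v' x, e u v -> e u' v' -> x \in C u v -> x \in C u' v' ->
     [set u; v] = [set u'; v']) ->
  exists B : T -> {set V}, [/\ forall u, B u \subset P,
    forall u, cut_connected adj (B u), forall u, B u != set0, disjoint_blocks B &
    forall u v, e u v -> exists x y, [/\ x \in B u, y \in B v & adj x y]].
Proof.
move=> sym e_sym eirr AP Ac A0 Ad CP CA CC.
(* [D] starts as [A u] and grows inside [C u v] until it is adjacent to [A v], without entering it.
   It has to stop because [C u v] itself reaches [A v]. *)
have grow u v : exists D, e u v -> [/\ cut_connected adj D, A u \subset D,
    D \subset A u :|: (C u v :\: A v) & exists x y, [/\ x \in D, y \in A v & adj x y]].
  suff H : e u v -> exists D, [/\ cut_connected adj D, A u \subset D,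
      D \subset A u :|: (C u v :\: A v) & exists x y, [/\ x \in D, y \in A v & adj x y]].
    by case uv: (e u v); [have [D HD] := H uv; exists D|exists set0].
  move=> uv.
  have [Cc _ /set0Pn[p /setIP[pu pC]] /set0Pn[q /setIP[qv qC]]] := CP u v uv.
  have uDv : u != v by apply: contraTneq uv => ->; rewrite eirr.
  suff {}H n D : #|C u v :\: D| <= n -> cut_connected adj D -> A u \subset D ->
      D \subset A u :|: (C u v :\: A v) -> exists D, [/\ cut_connected adj D,
    A u \subset D, D \subset A u :|: (C u v :\: A v) &
    exists x y, [/\ x \in D, y \in A v & adj x y]].
    exact: (H #|C u v :\: A u| (A u) (leqnn _) (Ac u) (subxx _) (subsetUl _ _)).
  elim: n D => [|n IHn] D cn Dc uD Du.
    have : q \in D by move: cn; rewrite leqn0 cards_eq0 setD_eq0 => /subsetP; exact.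
    move=> /(subsetP Du); rewrite !inE qv /= orbF => qu.
    by move/eqP: uDv; case; exact: Ad qu qv.
  have [||x [y [/setIP[xC xD] /setDP[yC yD] xy]]] := Cc D.
  - by exists p => //; exact: (subsetP uD).
  - apply/subsetPn; exists q => //; apply/negP => /(subsetP Du); rewrite !inE qv /= orbF => qu.
    by move/eqP: uDv; case; exact: Ad qu qv.
  have [yv|yv] := boolP (y \in A v); first by exists D; split=> //; exists x, y.
  apply: (IHn (y |: D)).
  - rewrite -ltnS; apply: leq_trans cn; apply/proper_card/properP; split.
      by apply: setDS; exact: subsetUr.
    by exists y; rewrite !inE ?yC ?yD // eqxx.
  - exact: cut_connectedU1 xy.
  - by apply: subset_trans uD _; exact: subsetUr.
  - by rewrite subUset Du andbT sub1set !inE yv yC orbT.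
have [D HD] := fin_all_exists (fun p : T * T => grow p.1 p.2).
(* Only the end of smaller rank absorbs part of an edge piece, which keeps the blocks disjoint. In
   [B], the index [None] stands for the vertex piece itself. *)
pose lt u v := e u v && (enum_rank u < enum_rank v).
pose B u := \bigcup_(o : option T | if o is Some v then lt u v else true)
  (if o is Some v then D (u, v) else A u).
have AB u : A u \subset B u by exact: (bigcup_sup None).
have DB u v : lt u v -> D (u, v) \subset B u by move=> uv; exact: (bigcup_sup (Some v)).
have memB u x : x \in B u -> x \in A u \/ exists2 v, lt u v & x \in C u v :\: A v.
  move=> /bigcupP[[v|] uv xB]; last by left.
  have /andP[euv _] := uv; have [_ _ /subsetP/(_ x xB) + _] := HD (u, v) euv.
  by rewrite inE => /orP[|]; [left|right; exists v].
have ltP u v : e u v -> lt u v \/ lt v u.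
  move=> uv; rewrite /lt uv (e_sym v) uv /=; case: (ltngtP (enum_rank u) (enum_rank v)); auto.
  by move=> /ord_inj/enum_rank_inj euv; rewrite euv eirr in uv.
exists B; split.
- move=> u; apply/subsetP => x /memB[/(subsetP (AP u))//|[v /andP[uv _] /setDP[xC _]]].
  by have [_ /subsetP/(_ x xC)] := CP u v uv.
- move=> u; case/set0Pn: (A0 u) => a au; apply: (@cut_connected_bigcup _ _ _ _ _ a).
    by move=> [v /andP[uv _]|_]; [have [] := HD (u, v) uv|exact: Ac].
  by move=> [v /andP[uv _]|_] //; have [_ /subsetP/(_ a au)] := HD (u, v) uv.
- move=> u; case/set0Pn: (A0 u) => a au; apply/set0Pn; exists a.
  exact: (subsetP (AB u)).
- have AD u u' v x : x \in A u -> lt u' v -> x \in C u' v :\: A v -> u = u'.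
    move=> xu /andP[uv _] /setDP[xC xv].
    by have [//|euv] := CA _ _ _ _ uv xC xu; rewrite euv (negPf xv) in xu.
  move=> u u' x /memB[xu|[v uv xv]] /memB[xu'|[v' uv' xv']].
  + exact: Ad xu xu'.
  + exact: AD xu uv' xv'.
  + by apply/esym; apply: AD xu' uv xv.
  + move: uv uv' xv xv' => /andP[uv l] /andP[uv' l'] /setDP[xC _] /setDP[xC' _].
    have es := CC _ _ _ _ _ uv uv' xC xC'.
    have: u \in [set u'; v'] by rewrite -es !inE eqxx.
    have: u' \in [set u; v] by rewrite es !inE eqxx.
    rewrite !inE => /orP[/eqP//|/eqP ev] /orP[/eqP//|/eqP ev'].
    by move: l'; rewrite ev -ev' => /(ltn_trans l); rewrite ltnn.
- move=> u v uv; case: (ltP u v uv) => l.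
    have [_ _ _ [x [y [xD yv xy]]]] := HD (u, v) uv.
    by exists x, y; split=> //; [exact: (subsetP (DB _ _ l))|exact: (subsetP (AB v))].
  have vu : e v u by rewrite e_sym.
  have [_ _ _ [x [y [xD yv xy]]]] := HD (v, u) vu.
  exists y, x; split=> //; last by rewrite sym.
    exact: (subsetP (AB u)).
  exact: (subsetP (DB _ _ l)).
Qed.

(** * Oriented coloring of minor-sparse graphs *)

Lemma leq_card_bigcup_sum (A B : finType) (P : pred A) (f : A -> {set B}) :
  #|\bigcup_(a | P a) f a| <= \sum_(a | P a) #|f a|.
Proof.
apply: (@big_ind2 _ _ (fun (X : {set B}) k => #|X| <= k)); rewrite ?cards0 //.
move=> X k Y l Xk Yl; apply: leq_trans (leq_add Xk Yl).
exact: (leq_card_setU X Y).1.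
Qed.

Lemma leq_card_bigcup (A B : finType) (P : {set A}) (f : A -> {set B}) m :
  (forall a, a \in P -> #|f a| <= m) -> #|\bigcup_(a in P) f a| <= #|P| * m.
Proof.
move=> fm; rewrite -sum_nat_const; apply: leq_trans (leq_card_bigcup_sum _ _) _.
exact: leq_sum.
Qed.

(** * Vertices of small degree with few second neighbors *)

Section PairCounting.
Variables (T : finType) (r : rel T) (L : {set T}).

Definition related_pairs : {set {set T}} :=
  [set p : {set T} | [exists u in L, exists v in L, r u v && (p == [set u; v])]].

Lemma related_pairsP (p : {set T}) :
  reflect (exists u v, [/\ u \in L, v \in L, r u v & p = [set u; v]])
          (p \in related_pairs).
Proof.
rewrite inE; apply: (iffP exists_inP) => [[u uL /exists_inP[v vL /andP[uv /eqP->]]]|].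
  by exists u, v.
move=> [u [v [uL vL uv ->]]]; exists u => //; apply/exists_inP; exists v => //.
by rewrite uv eqxx.
Qed.

Lemma degree_sum : irreflexive r ->
  \sum_(v in L) #|[set u in L | r v u]| <= 2 * #|related_pairs|.
Proof.
move=> rirr.
have ne u v : r u v -> u != v by apply: contraTneq => ->; rewrite rirr.
apply: (@leq_trans (\sum_(v in L) #|[set p : {set T} in related_pairs | v \in p]|)).
  apply: leq_sum => v vL.
  rewrite -(@card_in_imset _ _ (fun u => [set v; u])); last first.
    move=> u u' /setIdP[_ vu] /setIdP[_ vu'] /setP/(_ u); rewrite !inE eqxx orbT.
    by move/esym/orP => [/eqP e|/eqP//]; move: (ne _ _ vu); rewrite e eqxx.
  apply/subset_leq_card/subsetP => _ /imsetP[u /setIdP[uL vu] ->].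
  by rewrite inE !inE eqxx andbT; apply/exists_inP; exists v => //;
     apply/exists_inP; exists u; rewrite // vu eqxx.
under eq_bigr do rewrite -sum1_card.
rewrite (exchange_big_dep (mem related_pairs)) /=; last by move=> v p _; rewrite inE => /andP[].
rewrite mulnC -sum_nat_const; apply: leq_sum => p pr.
have /related_pairsP[u [v [_ _ uv ep]]] := pr.
rewrite sum1_card (@leq_trans #|p|) //; last by rewrite ep cards2 ne.
by apply/subset_leq_card/subsetP => x; rewrite unfold_in /= inE => /and3P[].
Qed.

End PairCounting.

Section ShallowMinor.
Variables (T : finType) (e : rel T) (g : nat).
Hypotheses (e_sym : symmetric e) (e_irr : irreflexive e) (sparse : minor_sparse e g).
Variable L : {set T}.

Let r2 : rel T := fun v u => (u != v) && [exists w, [&& w \notin L, e w u & e w v]].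

Lemma induced_edges : #|related_pairs e L| <= 3 * #|L| + 3 * g.
Proof.
pose B u := if u \in L then [set u] else set0.
have memB x u : x \in B u -> x = u /\ u \in L.
  by rewrite /B; case: ifP => uL; rewrite inE // => /eqP.
have tB : related_pairs e L \subset touching e B.
  apply/subsetP => p /related_pairsP[u [v [uL vL uv ->]]].
  apply/touchingP; exists u, v, u, v; rewrite /B uL vL !set11; split=> //.
  by apply: contraTneq uv => ->; rewrite e_irr.
apply: leq_trans (subset_leq_card tB) _; apply: leq_trans (sparse _ _) _.
- move=> u; rewrite /B; case: ifP => _; first exact: cut_connected1.
  by move=> S [x]; rewrite inE.
- by move=> u v x /memB[<- _] /memB[].
- rewrite leq_add2r leq_mul2l; apply/orP; right; apply/subset_leq_card/subsetP.
  by move=> u; rewrite inE => /set0Pn[x /memB[]].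
Qed.

(* Contracting each matched outer vertex onto an end of its pair realises the
   matched pairs as edges of a minor on L. *)
Lemma subdivided_edges d :
  (forall w, w \notin L -> #|[set u in L | e w u]| <= d) ->
  #|related_pairs r2 L| <= (3 * #|L| + 3 * g) * ('C(d, 2)).+1.
Proof.
move=> deg.
(* A member [(w, p)] uses the outer vertex [w] as the midpoint of the pair [p]; [ok] lets every [w]
   and every [p] be used at most once. *)
pose valid (x : T * {set T}) :=
  [&& x.1 \notin L, #|x.2| == 2 & x.2 \subset [set u in L | e x.1 u]].
pose ok (M : {set T * {set T}}) := [forall x in M, valid x] &&
  [forall x in M, forall y in M, ((x.1 == y.1) || (x.2 == y.2)) ==> (x == y)].
have [M /maxsetP[/andP[/forall_inP Mv /forall_inP Mi] Mmax] _] : {M | maxset ok M & set0 \subset M}.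
  apply: maxset_exists; apply/andP; split; apply/forall_inP => x; rewrite inE //.
have {}Mi x y : x \in M -> y \in M -> x.1 = y.1 \/ x.2 = y.2 -> x = y.
  move=> xM yM xy; have /forall_inP/(_ y yM)/implyP H := Mi x xM.
  by apply/eqP/H; case: xy => ->; rewrite eqxx ?orbT.
have cM : #|M| <= 3 * #|L| + 3 * g.
  pose P u w := (w == u) || [exists p, ((w, p) \in M) && ([pick x in p] == Some u)].
  pose B u := if u \in L then \bigcup_(w | P u w) [set u; w] else set0.
  have memB x u : x \in B u -> u \in L /\
      (x = u \/ exists2 p, (x, p) \in M & [pick x in p] = Some u).
    rewrite /B; case: ifP => uL; rewrite ?inE // => /bigcupP[w Pw]; rewrite !inE.
    move=> /orP[/eqP->|/eqP->]; first by split=> //; left.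
    case/orP: Pw => [/eqP->|/existsP[p /andP[pM /eqP]]]; first by split=> //; left.
    by split=> //; right; exists p.
  have inL x p : (x, p) \in M -> x \notin L by move=> /Mv/and3P[].
  rewrite -(@card_in_imset _ _ snd); last by move=> x y xM yM h; apply: Mi => //; right.
  have tB : snd @: M \subset touching e B.
    apply/subsetP => _ /imsetP[[w p] wpM ->] /=.
    have /and3P[/= wL /cards2P[u' [v' [uv' ep]]] /subsetP sp] := Mv _ wpM.
    have [u pu] : exists u, [pick x in p] = Some u.
      by case: pickP => [u _|/(_ u')]; [exists u|rewrite ep !inE eqxx].
    have [v [uv {}ep]] : exists v, u != v /\ p = [set u; v].
      have : u \in p by move: pu; case: pickP => // x xp [<-].
      rewrite ep !inE => /orP[]/eqP->; first by exists v'.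
      by exists u'; rewrite eq_sym setUC.
    have /setIdP[uL wu] : u \in [set u in L | e w u] by apply: sp; rewrite ep !inE eqxx.
    have /setIdP[vL wv] : v \in [set u in L | e w u] by apply: sp; rewrite ep !inE eqxx orbT.
    apply/touchingP; exists u, v, w, v; split=> //.
      rewrite /B uL; apply/bigcupP; exists w; last by rewrite !inE eqxx orbT.
      by rewrite /P; apply/orP; right; apply/existsP; exists p; rewrite wpM pu eqxx.
    by rewrite /B vL; apply/bigcupP; exists v; rewrite ?inE ?eqxx // /P eqxx.
  apply: leq_trans (subset_leq_card tB) _; apply: leq_trans (sparse _ _) _.
  - move=> u; rewrite /B; case: ifP => uL; last by move=> S [x]; rewrite inE.
    apply: (@cut_connected_bigcup _ _ _ _ _ u) => w; last by rewrite !inE eqxx.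
    case/orP => [/eqP->|/existsP[p /andP[pM /eqP pu]]].
      by rewrite setUid; exact: cut_connected1.
    apply: cut_connected2 => //; rewrite e_sym.
    have /and3P[_ _ /subsetP/(_ u)] := Mv _ pM.
    by rewrite inE /= => H; have /andP[] : (u \in L) && e w u
      by apply: H; move: pu; case: pickP => // x xp [<-].
  - move=> u v x /memB[uL xu] /memB[vL xv].
    case: xu => [xu|[p pM pu]]; case: xv => [xv|[q qM qv]].
    + by rewrite -xu.
    + by move: (inL _ _ qM); rewrite xu uL.
    + by move: (inL _ _ pM); rewrite xv vL.
    + have [epq] : (x, p) = (x, q) by apply: Mi => //; left.
      by move: pu; rewrite epq qv => -[].
  - rewrite leq_add2r leq_mul2l; apply/orP; right; apply/subset_leq_card/subsetP.
    by move=> u; rewrite inE => /set0Pn[x /memB[]].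
apply: leq_trans (_ : #|M| * ('C(d, 2)).+1 <= _); last by rewrite leq_mul2r cM orbT.
pose draws w := [set p : {set T} | p \subset [set u in L | e w u] & #|p| == 2].
(* By maximality [(w, p)] shares a coordinate with a member of [M]: either [p] is matched, or [w]
   is, and then [p] is one of at most ['C(d, 2)] pairs around it. *)
have cov : related_pairs r2 L \subset \bigcup_(x in M) (x.2 |: draws x.1).
  apply/subsetP => p /related_pairsP[u [v [uL vL /andP[uv /existsP[w /and3P[wL wv wu]]] ep]]].
  have vwp : valid (w, p).
    by rewrite /valid /= wL ep cards2 (eq_sym u) uv subUset !sub1set !inE uL vL wu wv.
  have [/existsP[x /andP[xM xwp]]|nx] := boolP [exists x, (x \in M) && ((x.1 == w) || (x.2 == p))].
    apply/bigcupP; exists x => //; case/orP: xwp => /eqP ex.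
      by rewrite inE /draws ex; apply/orP; right; rewrite inE; case/and3P: vwp => _ -> ->.
    by rewrite !inE ex eqxx.
  have fresh x : x \in M -> x.1 <> w /\ x.2 <> p.
    by move=> xM; split=> ex; case/existsP: nx; exists x; rewrite xM ex eqxx ?orbT.
  have /Mmax/(_ (subsetUr _ _)) eM : ok ((w, p) |: M).
    apply/andP; split; first by apply/forall_inP => x /setU1P[->|/Mv].
    apply/forall_inP => x /setU1P[->|xM]; apply/forall_inP => y /setU1P[->|yM]; apply/implyP.
    - by [].
    - by case: (fresh y yM) => ? ? /= /orP[]/eqP/esym.
    - by case: (fresh x xM) => ? ? /= /orP[]/eqP.
    - by move=> xy; apply/eqP/Mi => //; case/orP: xy => /eqP; [left|right].
  have : (w, p) \in M by rewrite -eM setU11.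
  by move/fresh => [].
apply: leq_trans (subset_leq_card cov) _; apply: leq_card_bigcup => x xM.
have /Mv/and3P[xL _ _] := xM.
rewrite cardsU1; apply: (@leq_trans (1 + #|draws x.1|)).
  by rewrite leq_add2r; case: (_ \in _).
by rewrite ltnS /draws cards_draws leq_bin2l // deg.
Qed.

(* Averaging over L: weighting the degree by C(d, 2) + 1 makes both terms
   contribute at most 12 (C(d, 2) + 1) per vertex. *)
Lemma good_vertex d :
  23 < d -> g <= #|L| -> 0 < #|L| ->
  (forall w, w \notin L -> #|[set u in L | e w u]| <= d) ->
  exists2 v, v \in L & #|[set u in L | e v u]| <= d /\
    #|[set u in L | r2 v u]| <= d * ('C(d, 2)).+1.
Proof.
move=> d12 gL L0 deg; set c := ('C(_, 2)).+1.
pose f v := c * #|[set u in L | e v u]| + #|[set u in L | r2 v u]|.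
have [/exists_inP[v vL fv]|/exists_inPn H] := boolP [exists v in L, f v <= d * c].
  exists v => //; split; last exact: leq_trans (leq_addl _ _) fv.
  have : c * #|[set u in L | e v u]| <= c * d.
    by rewrite (mulnC c d); exact: leq_trans (leq_addr _ _) fv.
  by rewrite leq_pmul2l.
have low : #|L| * (d * c).+1 <= \sum_(v in L) f v.
  by rewrite -sum_nat_const; apply: leq_sum => v /H; rewrite -ltnNge.
have r2irr : irreflexive r2 by move=> x; rewrite /r2 eqxx.
have D1 := degree_sum L e_irr; have D2 := degree_sum L r2irr.
have E1 := induced_edges; have E2 := subdivided_edges deg.
have : #|L| * (24 * c).+1 <= #|L| * (24 * c).
  apply: leq_trans (_ : #|L| * (d * c).+1 <= _).
    by rewrite leq_mul2l ltnS leq_mul2r d12 !orbT.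
  apply: (leq_trans low); rewrite big_split /= -big_distrr /=.
  apply: (@leq_trans (c * (2 * (6 * #|L|)) + 2 * ((6 * #|L|) * c))); last by clear; nia.
  have six : 3 * #|L| + 3 * g <= 6 * #|L| by move: gL; clear; lia.
  apply: leq_add.
    rewrite leq_mul2l; apply/orP; right; apply: leq_trans D1 _; rewrite leq_mul2l /=.
    exact: leq_trans E1 six.
  apply: leq_trans D2 _; rewrite leq_mul2l /=; apply: leq_trans E2 _.
  by rewrite leq_mul2r six orbT.
by rewrite leq_pmul2l // ltnn.
Qed.

End ShallowMinor.

(** * Greedy coloring with orientation bits *)

Section OrientedColoring.
Variables (T : finType) (e arc : rel T) (g : nat).
Hypotheses (e_sym : symmetric e) (e_irr : irreflexive e) (sparse : minor_sparse e g).
Hypothesis arcE : forall u v, e u v -> arc u v = ~~ arc v u.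
Variables (d K : nat).
Hypotheses (d24 : 23 < d) (dK : d + d * ('C(d, 2)).+1 <= K).

(* Colors of L :\: Y together with the bits recording orientations; a vertex
   outside L sees distinct colors in L :\: Y, which is what keeps the bits of
   vertices added later well defined. *)
Let colored (L Y : {set T}) (c : T -> 'I_K.+1) (b : T -> 'I_K.+1 -> bool) :=
  [/\ Y \subset L, #|Y| <= g,
   forall w u u', w \notin L -> u \in L :\: Y -> u' \in L :\: Y ->
     e w u -> e w u' -> u != u' -> c u != c u',
   forall u v, u \in L :\: Y -> v \in L :\: Y -> e u v ->
     c u != c v /\ (c u < c v -> arc u v = b u (c v) (+) b v (c u)) &
   forall v, v \in L :\: Y -> #|[set y in Y | e v y]| <= d].

(** Vertices given by [good_vertex] are peeled off one at a time; the degree bound of each preserves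
    the hypothesis for the smaller [L]. Once [#|L| <= g], all that is left becomes [Y], and the
    colors are assigned in the reverse order. *)
Lemma layered_coloring (L : {set T}) :
  (forall w, w \notin L -> #|[set u in L | e w u]| <= d) ->
  exists Y c b, colored L Y c b.
Proof.
move: {2}#|L| (leqnn #|L|) => n; elim: n L => [|n IHn] L Ln deg.
  exists L, (fun=> ord0), (fun _ _ => false); split=> //; first exact: leq_trans Ln _.
  - by move=> w u u' _; rewrite setDv inE.
  - by move=> u v; rewrite setDv inE.
  - by move=> v; rewrite setDv inE.
have [Lg|gL] := leqP #|L| g.
  exists L, (fun=> ord0), (fun _ _ => false); split=> //.
  - by move=> w u u' _; rewrite setDv inE.
  - by move=> u v; rewrite setDv inE.
  - by move=> v; rewrite setDv inE.
have [v vL [dv pv]] := good_vertex e_sym e_irr sparse d24 (ltnW gL)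
  (leq_ltn_trans (leq0n _) gL) deg.
have cL : #|L :\ v| <= n by move: Ln; rewrite (cardsD1 v) vL.
have sub w : #|[set u in L :\ v | e w u]| <= #|[set u in L | e w u]|.
  by apply/subset_leq_card/subsetP => u; rewrite !inE -andbA => /andP[_].
have [|Y [c [b [YL Yg c1 c2 c3]]]] := IHn (L :\ v) cL.
  move=> w; rewrite !inE negb_and negbK => /orP[/eqP->|wL].
    exact: leq_trans (sub v) dv.
  exact: leq_trans (sub w) (deg w wL).
have vY : v \notin Y by apply/negP => /(subsetP YL); rewrite !inE eqxx.
pose near2 : rel T := fun v u => (u != v) && [exists w, [&& w \notin L, e w u & e w v]].
have {}pv : #|[set u in L | near2 v u]| <= d * ('C(d, 2)).+1 := pv.
(* Avoiding neighbors keeps the coloring proper; avoiding vertices with a common outer neighbor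
   keeps the colors seen from outside [L] distinct. At most [K] of the [K.+1] colors are
   excluded. *)
pose bad := c @: ([set u in L | e v u] :|: [set u in L | near2 v u]).
have /existsP[col colN] : [exists j, j \notin bad].
  rewrite -negb_forall; apply/negP => /forallP full.
  have : K.+1 <= #|bad|.
    by rewrite -[X in X <= _]card_ord; apply/subset_leq_card/subsetP => j _.
  rewrite ltnNge => /negP; apply; apply: leq_trans (leq_imset_card _ _) _.
  apply: leq_trans dK; apply: leq_trans (leq_card_setU _ _).1 _.
  exact: leq_add.
have colE u : u \in L -> e v u || near2 v u -> c u != col.
  move=> uL vu; apply: contraNneq colN => <-; apply: imset_f.
  by rewrite !inE uL; case/orP: vu => ->; rewrite ?orbT.
pose c' x := if x == v then col else c x.
pose orient u (j : 'I_K.+1) := if j < col then arc u v else arc v u.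
pose nb j u := [&& u \in (L :\ v) :\: Y, e v u & c u == j].
(* Earlier bits are not touched: the bit of [v] at color [c u] compensates for whatever [u] already
   stores at [col]. The earlier neighbors of [v] outside [Y] have distinct colors, so no two of them
   compete for one bit. *)
pose b' x j := if x == v then
  (if [pick u | nb j u] is Some u then b u col (+) orient u j else false) else b x j.
have inL' u : u \in L :\: Y -> u != v -> u \in (L :\ v) :\: Y by rewrite !inE => /andP[-> ->] ->.
have c'v : c' v = col by rewrite /c' eqxx.
have c'N u : u != v -> c' u = c u by rewrite /c' => /negPf->.
have newb u : u \in L :\: Y -> u != v -> e v u -> b' v (c u) = b u col (+) orient u (c u).
  move=> uL uv vu; rewrite /b' eqxx; case: pickP => [x /and3P[xL vx /eqP cx]|/(_ u)].
    have [->//|xu] := eqVneq x u.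
    have vN : v \notin L :\ v by rewrite !inE eqxx.
    by have := c1 v x u vN xL (inL' u uL uv) vx vu xu; rewrite cx eqxx.
  by rewrite /nb (inL' u uL uv) vu eqxx.
have colv u : u \in L :\: Y -> u != v -> e v u -> c u != col.
  by move=> /setDP[uL _] uv vu; apply: colE => //; rewrite vu.
exists Y, c', b'; split=> //.
- by apply: subset_trans YL _; exact: subsetDl.
- move=> w u u' wL; have wv : w != v by apply: contraNneq wL => ->.
  have wL' : w \notin L :\ v by rewrite !inE negb_and wL orbT.
  have sep x : x \in L :\: Y -> x != v -> e w v -> e w x -> c x != col.
    move=> /setDP[xL _] xv wvE wx; apply: colE => //; apply/orP; right.
    by rewrite /near2 xv /=; apply/existsP; exists w; rewrite wL wx wvE.
  move=> uL u'L wu wu' uu'.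
  have [ev|uv] := eqVneq u v; have [ev'|u'v] := eqVneq u' v.
  + by move: uu'; rewrite ev ev' eqxx.
  + by rewrite ev c'v c'N // eq_sym; apply: sep => //; rewrite -ev.
  + by rewrite ev' c'v c'N //; apply: sep => //; rewrite -ev'.
  + by rewrite !c'N //; apply: c1 wL' (inL' u uL uv) (inL' u' u'L u'v) wu wu' uu'.
- move=> u w uL wL uw.
  have [eu|uv] := eqVneq u v; have [ew|wv] := eqVneq w v.
  + by move: uw; rewrite eu ew e_irr.
  + rewrite eu c'v c'N //; have vw : e v w by rewrite -eu.
    split=> [|lt]; first by rewrite eq_sym colv.
    rewrite newb // /orient ltnNge (ltnW lt) /= /b' (negPf wv).
    by rewrite addbAC addbb.
  + have vu : e v u by rewrite e_sym -ew.
    rewrite ew c'v c'N //; split=> [|lt]; first exact: colv.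
    rewrite newb // /orient lt /b' (negPf uv).
    by rewrite addbA addbb.
  + rewrite !c'N // /b' (negPf uv) (negPf wv).
    exact: c2 (inL' u uL uv) (inL' w wL wv) uw.
- move=> u uL; have [->|uv] := eqVneq u v; last exact: c3 (inL' u uL uv).
  apply: leq_trans dv; apply/subset_leq_card/subsetP => y; rewrite !inE.
  by move=> /andP[/(subsetP YL)/setD1P[_ ->]].
Qed.

Hypothesis g0 : 0 < g.

Definition color_type : finType :=
  ('I_g + 'I_K.+1 * {ffun 'I_K.+1 -> bool} * {ffun 'I_d -> option ('I_g * bool)})%type.

(** An edge avoiding [Y] is decoded from the two colors and bits, an edge with one end in [Y] from
    the list stored at its other end, and an edge inside [Y] from its ends, which have private
    colors. *)
Lemma oriented_color_map : exists phi : T -> color_type,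
  (forall u v, e u v -> phi u != phi v) /\
  (forall u v u' v', e u v -> e u' v' -> phi u = phi u' -> phi v = phi v' ->
     arc u v = arc u' v').
Proof.
have [|Y [c [b [_ Yg _ c2 c3]]]] := @layered_coloring setT; first by move=> w; rewrite inE.
have inN x : (x \in setT :\: Y) = (x \notin Y) by rewrite !inE andbT.
have [idx idx_inj] : exists idx : T -> 'I_g, {in Y &, injective idx}.
  have idx_lt x : (if x \in Y then index x (enum Y) else 0) < g.
    by case: ifP => // xY; apply: leq_trans Yg; rewrite cardE index_mem mem_enum.
  exists (fun x => Ordinal (idx_lt x)) => x y xY yY [].
  rewrite xY yY => h; have := congr1 (nth x (enum Y)) h.
  by rewrite !nth_index ?mem_enum.
pose nbrs x := [seq Some (idx y, arc x y) | y <- enum [set y in Y | e x y]].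
pose phi x : color_type := if x \in Y then inl (idx x)
  else inr (c x, [ffun j => b x j], [ffun i : 'I_d => nth None (nbrs x) i]).
(* The entry for [y] in the list of [x] also occurs, at the same position, in the list of [x'];
   injectivity of [idx] on [Y] shows that it describes [y] there too. *)
have to_Y x x' y : x \notin Y -> x' \notin Y -> y \in Y -> e x y -> e x' y ->
    phi x = phi x' -> arc x y = arc x' y.
  move=> xY x'Y yY xy x'y; rewrite /phi (negPf xY) (negPf x'Y) => -[_ _ /ffunP E].
  have y_in : y \in enum [set y in Y | e x y] by rewrite mem_enum inE yY.
  have lt : index y (enum [set y in Y | e x y]) < d.
    apply: leq_trans (c3 x _); last by rewrite inN.
    by rewrite cardE index_mem.
  have := E (Ordinal lt); rewrite !ffunE /= /nbrs.
  rewrite (nth_map y) ?index_mem // nth_index //.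
  set i := index _ _; have [il|il] := ltnP i (size (enum [set y in Y | e x' y])); last first.
    by rewrite nth_default // size_map.
  rewrite (nth_map y) // => -[ei ->]; congr (arc x' _); apply/esym/idx_inj => //.
  by have := mem_nth y il; rewrite mem_enum inE => /andP[].
exists phi; split=> [u v uv|u v u' v' uv uv'].
  apply/eqP; rewrite /phi; case: ifPn => uY; case: ifPn => vY //.
    by move=> [/(idx_inj _ _ uY vY) euv]; rewrite euv e_irr in uv.
  have [||+ _] := c2 u v _ _ uv; rewrite ?inN //.
  by move=> /eqP cuv [].
have phiY x x' : phi x = phi x' -> (x \in Y) = (x' \in Y) /\ (x \in Y -> x = x').
  rewrite /phi; case: ifPn => xY; case: ifPn => x'Y // [].
  by move/idx_inj => /(_ xY x'Y).
move=> eu ev; have [uY uu] := phiY _ _ eu; have [vY vv] := phiY _ _ ev.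
have [uinY|uN] := boolP (u \in Y); have [vinY|vN] := boolP (v \in Y).
- by rewrite uu // vv.
- have euu := uu uinY; rewrite -euu in uv' *.
  rewrite (arcE uv) (arcE uv'); congr (~~ _).
  by apply: to_Y; rewrite -?vY // e_sym.
- have evv := vv vinY; rewrite -evv in uv' *.
  by apply: to_Y; rewrite -?uY.
have u'N : u' \notin Y by rewrite -uY.
have v'N : v' \notin Y by rewrite -vY.
move: eu ev; rewrite /phi (negPf uN) (negPf vN) (negPf u'N) (negPf v'N).
move=> [ecu /ffunP ebu _] [ecv /ffunP ebv _].
have bu j : b u j = b u' j by have := ebu j; rewrite !ffunE.
have bv j : b v j = b v' j by have := ebv j; rewrite !ffunE.
have vu : e v u by rewrite e_sym.
have vu' : e v' u' by rewrite e_sym.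
have [||cuv Auv] := c2 u v _ _ uv; rewrite ?inN //.
have [||_ Auv'] := c2 u' v' _ _ uv'; rewrite ?inN //.
have [||_ Avu] := c2 v u _ _ vu; rewrite ?inN //.
have [||_ Avu'] := c2 v' u' _ _ vu'; rewrite ?inN //.
have [lt|lt|/ord_inj e0] := ltngtP (c u) (c v).
- by rewrite Auv // Auv' -?ecu -?ecv // bu bv.
- by rewrite (arcE uv) (arcE uv') Avu // Avu' -?ecu -?ecv // bu bv.
- by move: cuv; rewrite e0 eqxx.
Qed.

End OrientedColoring.

Lemma card_color_type g d K :
  #|color_type g d K| = g + (K.+1 * 2 ^ K.+1) * (g * 2).+1 ^ d.
Proof.
by rewrite card_sum !card_prod !card_ffun !card_ord card_bool card_option card_prod card_ord card_bool.
Qed.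

(** * Subdividing a triangulation *)

Section PseudosurfaceCounting.
Variables (V : finType) (F : {set {set V}}).
Hypothesis surfF : closed_pseudosurface F.

Lemma sum_vertex_degrees : \sum_(x in cover F) #|[set t : {set V} in F | x \in t]| = 3 * #|F|.
Proof.
have [F3 _ _] := surfF.
under eq_bigr do rewrite -sum1_card.
rewrite (exchange_big_dep (mem F)) /=; last by move=> x t _; rewrite inE => /andP[].
rewrite mulnC -sum_nat_const; apply: eq_bigr => t tF; rewrite -(F3 t tF) -[RHS]sum1_card.
apply: eq_bigl => x; rewrite inE tF /=; apply: andb_idl => xt.
by apply/bigcupP; exists t.
Qed.

Lemma card_sides : 2 * #|sides F| = 3 * #|F|.
Proof.
have [F3 F2 _] := surfF.
rewrite mulnC -sum_nat_const (eq_bigr (fun s : {set V} => #|cofaces F s|)); last by move=> s /F2.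
under eq_bigr do rewrite -sum1_card.
rewrite (exchange_big_dep (mem F)) /=; last by move=> s t _; rewrite inE => /andP[].
rewrite mulnC -sum_nat_const; apply: eq_bigr => t tF.
have -> : 3 = #|[set s : {set V} | s \subset t & #|s| == 2]| by rewrite cards_draws F3.
rewrite -[RHS]sum1_card; apply: eq_bigl => s; rewrite !inE tF /= andbC.
have [st|//] := boolP (s \subset t); rewrite /= andb_idr // => _.
by apply/exists_inP; exists t.
Qed.

End PseudosurfaceCounting.

Section Lattice.
Variables (W : finType) (K2 : {set {set W}}) (n : nat).
Hypothesis surfK : closed_pseudosurface K2.

(* Subdivision of every triangle into (n+1)^2 small ones.  A vertex is given by
   its barycentric coordinates multiplied by n+1; the same type also holds the
   points of weight n and n+2 that index upward and downward triangles. *)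
Local Notation V := {ffun W -> 'I_n.+3}.
Implicit Types (x y z m : V) (sg : {set W}) (t : {set V}).

Definition weight x := \sum_w x w.
Definition supp x := [set w | x w != ord0].
Definition step a z x := [forall w, x w == z w + (w == a) :> nat].
Definition up sg z : {set V} := [set x | [exists a in sg, step a z x]].
Definition down sg y : {set V} := [set x | [exists a in sg, step a x y]].

(** Upward triangles add a unit to [z] and downward ones subtract it, which needs positive
    coordinates: hence the exact support in the second case. *)
Definition lattice_triangles : {set {set V}} :=
  [set t : {set V} | [exists sg in K2, exists z,
     [&& weight z == n, supp z \subset sg & t == up sg z] ||
     [&& weight z == n.+2, supp z == sg & t == down sg z]]].
Local Notation F := lattice_triangles.

Lemma latticeP t : reflect (exists2 sg, sg \in K2 & exists z,
    [/\ weight z = n, supp z \subset sg & t = up sg z] \/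
    [/\ weight z = n.+2, supp z = sg & t = down sg z]) (t \in F).
Proof.
rewrite inE; apply: (iffP exists_inP) => [[sg sK /existsP[z /orP H]]|[sg sK [z H]]].
  by exists sg => //; exists z; case: H => /and3P[/eqP ? H1 /eqP ?]; [left|right; move/eqP: H1].
exists sg => //; apply/existsP; exists z; apply/orP.
case: H => -[-> H ->]; [left|right]; first by rewrite H !eqxx.
by rewrite H !eqxx.
Qed.

Lemma stepP a z x : reflect (forall w, x w = z w + (w == a) :> nat) (step a z x).
Proof. by apply: (iffP forallP) => H w; apply/eqP. Qed.

Lemma lattice_ext x y : (forall w, x w = y w :> nat) -> x = y.
Proof. by move=> H; apply/ffunP => w; apply/val_inj/H. Qed.

Definition mkpoint (f : W -> nat) : V := [ffun w => inord (f w)].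

Lemma mkpointE f w : f w <= n.+2 -> mkpoint f w = f w :> nat.
Proof. by move=> fw; rewrite ffunE inordK. Qed.

Lemma le_weight x w : x w <= weight x.
Proof. by rewrite /weight (bigD1 w) //= leq_addr. Qed.

Lemma weight_step a z x : step a z x -> weight x = (weight z).+1.
Proof.
move=> /stepP H; rewrite /weight (eq_bigr _ (fun w _ => H w)) big_split /= -[RHS]addn1; congr addn.
by rewrite (bigD1 a) //= eqxx big1 // => w /negPf->.
Qed.

Lemma step_up a z : weight z <= n.+1 -> exists x, step a z x.
Proof.
move=> zn; exists (mkpoint (fun w => z w + (w == a))); apply/stepP => w.
by rewrite mkpointE //; have := le_weight z w; case: (w == a); lia.
Qed.

Lemma step_down a x : a \in supp x -> exists z, step a z x.
Proof.
rewrite inE => xa; exists (mkpoint (fun w => x w - (w == a))); apply/stepP => w.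
rewrite mkpointE; last by have := ltn_ord (x w); lia.
case: eqP => [->|_]; last by rewrite subn0 addn0.
by rewrite subnK // lt0n; apply: contra xa => /eqP xa; apply/eqP/val_inj.
Qed.

Lemma supp_step a z x : step a z x -> supp x = a |: supp z.
Proof.
move=> /stepP H; apply/setP => w; rewrite !inE -!(inj_eq val_inj) /= H.
by case: (w == a); rewrite ?addn1 ?addn0.
Qed.

Lemma mem_supp x a : (a \in supp x) = (0 < x a).
Proof. by rewrite inE -(inj_eq val_inj) lt0n. Qed.

Lemma step_inj_base a z z' x : step a z x -> step a z' x -> z = z'.
Proof.
move=> /stepP H /stepP H'; apply: lattice_ext => w.
by have := H w; rewrite H' => /addIn.
Qed.

Lemma step_inj_tip a z x x' : step a z x -> step a z x' -> x = x'.
Proof. by move=> /stepP H /stepP H'; apply: lattice_ext => w; rewrite H H'. Qed.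

Lemma step_inj_dir a b z x : step a z x -> step b z x -> a = b.
Proof.
move=> /stepP H /stepP /(_ a); rewrite H eqxx => /addnI.
by case: eqP.
Qed.

Lemma step_commute a b z x y : step a z x -> step b x y -> exists2 x', step b z x' & step a x' y.
Proof.
move=> H H'; have /stepP/(_ b) := H'; rewrite eqxx => yb.
have [|x' sx'] := @step_down a y.
  by rewrite (supp_step H') (supp_step H) !inE eqxx orbT.
exists x' => //; apply/stepP => w; move: H H' sx' => /stepP/(_ w) A /stepP/(_ w) B /stepP/(_ w) C.
by move: C; rewrite B A; lia.
Qed.

(** The difference of [x] and [y] is a difference of two unit vectors, which determines both
    directions. *)
Lemma parallel_up a b i j z z' x y : a != b -> step a z x -> step b z y ->
  step i z' x -> step j z' y -> [/\ i = a, j = b & z' = z].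
Proof.
move=> ab za zb zi zj.
have E w : (w == a) + (w == j) = (w == b) + (w == i).
  move: za zb zi zj => /stepP/(_ w) A /stepP/(_ w) B /stepP/(_ w) C /stepP/(_ w) D.
  by move: C D; rewrite A B; lia.
have ia : i = a.
  have := E a; rewrite eqxx (negPf ab); case: (a =P i) => [->//|_]; lia.
rewrite ia in zi E *; have zz := step_inj_base zi za.
by rewrite zz in zj *; split=> //; exact: step_inj_dir zj zb.
Qed.

Lemma parallel_down a b i j z x y y0 : a != b -> step a z x -> step b z y ->
  step i x y0 -> step j y y0 -> i = b /\ j = a.
Proof.
move=> ab za zb xi yj.
have E w : (w == a) + (w == i) = (w == b) + (w == j).
  move: za zb xi yj => /stepP/(_ w) A /stepP/(_ w) B /stepP/(_ w) C /stepP/(_ w) D.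
  by move: C; rewrite D A B; lia.
split.
  have := E b; rewrite eqxx [b == a]eq_sym (negPf ab); case: (b =P i) => [->//|_]; lia.
have := E a; rewrite eqxx (negPf ab); case: (a =P j) => [->//|_]; lia.
Qed.

Lemma upP sg z x : reflect (exists2 a, a \in sg & step a z x) (x \in up sg z).
Proof. by rewrite inE; exact: exists_inP. Qed.

Lemma downP sg y x : reflect (exists2 a, a \in sg & step a x y) (x \in down sg y).
Proof. by rewrite inE; exact: exists_inP. Qed.

Lemma card_up sg z : weight z <= n.+1 -> #|up sg z| = #|sg|.
Proof.
move=> zn; have [f Hf] := fin_all_exists (fun a => step_up a zn).
rewrite (_ : up sg z = f @: sg).
  by apply: card_imset => a b e; apply: (@step_inj_dir _ _ z (f a)); rewrite // e.
apply/setP => x; apply/upP/imsetP => [[a asg zx]|[a asg ->]]; exists a => //.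
exact: step_inj_tip zx (Hf a).
Qed.

Lemma card_down y : #|down (supp y) y| = #|supp y|.
Proof.
have [f Hf] : exists f : W -> V, forall a, a \in supp y -> step a (f a) y.
  apply: (fin_all_exists (P := fun a u => a \in supp y -> step a u y)) => a.
  by case: (boolP (a \in supp y)) => [/step_down[z]|_]; [exists z|exists y].
rewrite (_ : down _ y = f @: supp y).
  apply: card_in_imset => a b aS bS e; apply: (@step_inj_dir _ _ (f a) y); first exact: Hf.
  by rewrite e; exact: Hf.
apply/setP => x; apply/downP/imsetP => [[a asg zx]|[a asg ->]]; exists a => //; last exact: Hf.
exact: step_inj_base zx (Hf a asg).
Qed.

Let K3 sg : sg \in K2 -> #|sg| = 3. Proof. by case: surfK => K3 _ _; exact: K3. Qed.

Lemma lattice_card t : t \in F -> #|t| = 3.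
Proof.
move=> /latticeP[sg sK [z [[zn _ ->]|[_ zsg ->]]]].
  by rewrite card_up ?zn ?K3 // ltnW.
by rewrite -zsg card_down zsg K3.
Qed.

Lemma coverP x : reflect (weight x = n.+1 /\ exists2 sg, sg \in K2 & supp x \subset sg)
  (x \in cover F).
Proof.
apply: (iffP bigcupP) => [[t /latticeP[sg sK [z H]] xt]|[xn [sg sK xs]]].
  case: H => -[zn zs et]; rewrite et in xt.
    case/upP: xt => a asg zx; split; first by rewrite (weight_step zx) zn.
    by exists sg => //; rewrite (supp_step zx) subUset sub1set asg.
  case/downP: xt => a asg zx; split; first by move: (weight_step zx); rewrite zn => -[].
  by exists sg => //; rewrite -zs (supp_step zx) subsetUr.
have /existsP[a xa] : [exists a, 0 < x a].
  apply: contraT => /existsPn H; move: xn; rewrite /weight big1 // => a _.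
  by have := H a; rewrite lt0n negbK => /eqP.
rewrite -mem_supp in xa; have [z zx] := step_down xa.
have asg : a \in sg by apply: (subsetP xs).
exists (up sg z); last by apply/upP; exists a.
apply/latticeP; exists sg => //; exists z; left; split=> //.
  by have := weight_step zx; rewrite xn => -[].
by apply: subset_trans xs; rewrite (supp_step zx) subsetUr.
Qed.

(** A side of a downward triangle gets the same normal form by subtracting both of its directions
    from the top point. *)
Lemma lattice_sideP s : s \in sides F -> exists z a b x y sg,
  [/\ s = [set x; y], a != b /\ weight z = n, step a z x /\ step b z y, sg \in K2 &
      a |: (b |: supp z) \subset sg].
Proof.
rewrite inE => /andP[/cards2P[x [y [xy ->]]] /exists_inP[t /latticeP[sg sK [z H]]]].
rewrite subUset !sub1set => /andP[].
case: H => -[zn zs ->].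
  move=> /upP[a asg zx] /upP[b bsg zy]; exists z, a, b, x, y, sg; split=> //; last by rewrite !subUset !sub1set asg bsg.
  by split=> //; apply: contraNneq xy => ab; rewrite ab in zx; rewrite (step_inj_tip zx zy).
move=> /downP[a asg zx] /downP[b bsg zy].
have ab : a != b by apply: contraNneq xy => ab; rewrite ab in zx; rewrite (step_inj_base zx zy).
have bx : b \in supp x.
  have : b \in supp z by rewrite zs.
  by rewrite (supp_step zx) !inE eq_sym (negPf ab).
have [m mx] := step_down bx; have [x' mx' x'z] := step_commute mx zx.
have ex' : x' = y by exact: step_inj_base x'z zy.
rewrite ex' in mx'; exists m, b, a, x, y, sg; split=> //.
  by rewrite eq_sym; split=> //; have := weight_step zx; rewrite (weight_step mx) zn => -[].
by rewrite -zs (supp_step zx) (supp_step mx) setUCA.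
Qed.

Lemma up_inj z sg sg' : weight z <= n.+1 -> up sg z = up sg' z -> sg = sg'.
Proof.
move=> zn; suff H sg1 sg2 : up sg1 z = up sg2 z -> sg1 \subset sg2.
  by move=> e; apply/eqP; rewrite eqEsubset !H.
move=> e; apply/subsetP => w ws; have [x wx] := step_up w zn.
have : x \in up sg2 z by rewrite -e; apply/upP; exists w.
by case/upP => w' w's /(step_inj_dir wx)->.
Qed.

Lemma mem_up sg z a x : a \in sg -> step a z x -> x \in up sg z.
Proof. by move=> asg zx; apply/upP; exists a. Qed.

Lemma mem_down sg y a x : a \in sg -> step a x y -> x \in down sg y.
Proof. by move=> asg zx; apply/downP; exists a. Qed.

Lemma up_in_lattice sg z : sg \in K2 -> weight z = n -> supp z \subset sg -> up sg z \in F.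
Proof. by move=> sK zn zs; apply/latticeP; exists sg => //; exists z; left. Qed.

Lemma down_in_lattice sg y : sg \in K2 -> weight y = n.+2 -> supp y = sg -> down sg y \in F.
Proof. by move=> sK yn ys; apply/latticeP; exists sg => //; exists y; right. Qed.

(** [T] is the coarse face carrying the side. If it is a triangle, the side lies in one upward and
    one downward triangle; if it is a coarse side, each of the two coarse triangles there
    contributes an upward one. *)
Lemma lattice_cofaces s : s \in sides F -> #|cofaces F s| = 2.
Proof.
move=> /lattice_sideP[z [a [b [x [y [sg [-> [ab zn] [za zb] sK Tsg]]]]]]].
set T := a |: (b |: supp z) in Tsg.
have xn : weight x = n.+1 by rewrite (weight_step za) zn.
have [y0 xy0] := step_up b (eq_leq xn).
have yy0 : step a y y0.
  have [x' zx' x'y0] := step_commute za xy0.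
  by rewrite (step_inj_tip zb zx').
have y0n : weight y0 = n.+2 by rewrite (weight_step xy0) xn.
have Ty0 : supp y0 = T by rewrite (supp_step xy0) (supp_step za) setUCA.
have aT : a \in T by rewrite !inE eqxx.
have bT : b \in T by rewrite !inE eqxx orbT.
have zT : supp z \subset T by rewrite /T setUA subsetUr.
have mem_cof t : (t \in cofaces F [set x; y]) = [&& t \in F, x \in t & y \in t].
  by rewrite inE subUset !sub1set.
have up_cof sg' : sg' \in K2 -> T \subset sg' -> up sg' z \in cofaces F [set x; y].
  move=> s'K Ts'; rewrite mem_cof up_in_lattice ?(subset_trans zT) //=.
  by rewrite (mem_up _ za) ?(mem_up _ zb) // (subsetP Ts').
have class t : t \in cofaces F [set x; y] ->
    (exists2 sg', sg' \in K2 & T \subset sg' /\ t = up sg' z) \/ T \in K2 /\ t = down T y0.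
  rewrite mem_cof => /and3P[/latticeP[sg' s'K [z' H]] xt yt].
  case: H => -[z'n z's et]; rewrite et in xt yt *.
    case/upP: xt => i is' z'x; case/upP: yt => j js' z'y.
    have [ia jb zz] := parallel_up ab za zb z'x z'y; subst i j z'.
    by left; exists sg' => //; split=> //; rewrite /T !subUset !sub1set is' js'.
  case/downP: xt => i is' z'x; case/downP: yt => j js' z'y.
  have [ib ja] := parallel_down ab za zb z'x z'y; subst i j.
  have e0 := step_inj_tip z'x xy0; subst z'.
  by right; rewrite -Ty0 z's.
have T2 : 1 < #|T|.
  rewrite (cardsD1 a) aT (cardsD1 b) !inE eqxx orbT eq_sym ab //.
have := subset_leq_card Tsg; rewrite (K3 sK) leq_eqVlt ltnS => /predU1P[T3|T2'].
  have eT : T = sg by apply/eqP; rewrite eqEcard Tsg T3 (K3 sK).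
  have -> : cofaces F [set x; y] = [set up T z; down T y0].
    apply/setP => t; rewrite in_set2; apply/idP/orP => [/class|].
      case=> [[sg' s'K [Ts' ->]]|[_ ->]]; [left|by right].
      by apply/eqP; congr (up _ z); apply/esym/eqP; rewrite eqEcard Ts' T3 (K3 s'K).
    case=> /eqP->; first by apply: up_cof => //; rewrite eT.
    rewrite mem_cof down_in_lattice ?eT //=; last by rewrite -eT.
    by rewrite -eT (mem_down bT xy0) (mem_down aT yy0).
  rewrite cards2; case: eqP => // e.
  (* The two triangles differ: the upward vertex in the third direction [c] is not below [y0]. *)
  have [c cT /andP[ca cb]] : exists2 c, c \in T & (c != a) && (c != b).
    have : 0 < #|T :\ a :\ b|.
      have := cardsD1 a T; have := cardsD1 b (T :\ a); rewrite !inE T3 !eqxx orbT eq_sym ab /=.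
      by clear; lia.
    by case/card_gt0P => c; rewrite !inE => /and3P[cb ca cT]; exists c; rewrite ?ca ?inE.
  have [v zv] := step_up c (leq_trans (eq_leq zn) (leqnSn n)).
  have : v \in down T y0 by rewrite -e (mem_up cT zv).
  case/downP => i _ vy0.
  move: zv vy0 xy0 za => /stepP/(_ c) A /stepP/(_ c) B /stepP/(_ c) C /stepP/(_ c).
  by rewrite (negPf ca) => D; move: B; rewrite C D A eqxx (negPf cb); clear; lia.
have {}T2 : #|T| = 2 by apply/eqP; rewrite eqn_leq T2' T2.
have TK : T \in sides K2 by rewrite inE T2 eqxx; apply/exists_inP; exists sg.
have [_ K22 _] := surfK; rewrite -(K22 T TK).
have -> : cofaces F [set x; y] = (fun sg' => up sg' z) @: cofaces K2 T.
  apply/setP => t; apply/idP/imsetP => [/class|[sg' /setIdP[s'K Ts'] ->]]; last exact: up_cof.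
  case=> [[sg' s'K [Ts' ->]]|[/K3]]; last by rewrite T2.
  by exists sg' => //; rewrite inE s'K.
by apply: card_in_imset => sg1 sg2 _ _; apply: up_inj; rewrite zn.
Qed.

Lemma exceeds x y : weight x = weight y -> x != y -> exists a, y a < x a.
Proof.
move=> xy nxy; apply/existsP; apply: contraT => /existsPn le.
have {}le a : x a <= y a by rewrite leqNgt; exact: le.
case/eqP: nxy; apply: lattice_ext => w; apply/eqP; rewrite eqn_leq le leqNgt.
apply/negP => lt; have : weight x < weight y; last by rewrite xy ltnn.
rewrite /weight (bigD1 w) // [X in _ < X](bigD1 w) //= -addSn.
by apply: leq_add => //; apply: leq_sum.
Qed.

Lemma weight_supp x sg : supp x \subset sg -> weight x = \sum_(w in sg) x w.
Proof.
move=> xs; rewrite /weight (bigID (mem sg)) /= [X in _ + X]big1 ?addn0 // => w wsg.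
by apply/eqP; rewrite -leqn0 leqNgt -mem_supp; apply: contra wsg; exact: (subsetP xs).
Qed.

(** On three coordinates, equal weights and gaps of at most one leave only the gaps 1, -1 and 0, so
    the points are steps from a common base. *)
Lemma lattice_adj x y sg : weight x = n.+1 -> weight y = n.+1 -> x != y ->
  sg \in K2 -> supp x \subset sg -> supp y \subset sg ->
  (forall w, x w <= (y w).+1 /\ y w <= (x w).+1) -> side_adj F x y.
Proof.
move=> xn yn xy sK xs ys close.
have [a ya] := exceeds (etrans xn (esym yn)) xy.
have [|b xb] := exceeds (etrans yn (esym xn)); first by rewrite eq_sym.
have ea : x a = (y a).+1 :> nat by case: (close a); lia.
have eb : y b = (x b).+1 :> nat by case: (close b); lia.
have asg : a \in sg by apply: (subsetP xs); rewrite mem_supp ea.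
have bsg : b \in sg by apply: (subsetP ys); rewrite mem_supp eb.
have ab : a != b by apply/eqP => e; move: ea eb; rewrite e; lia.
have [|z zx] := @step_down a x; first by rewrite mem_supp ea.
have zn : weight z = n by have := weight_step zx; rewrite xn => -[].
have zy : step b z y.
  apply/stepP => w; have := stepP _ _ _ zx w.
  have [->|wa] := eqVneq w a; first by rewrite ea (negPf ab) addn1 addn0 => -[].
  have [->|wb] := eqVneq w b; first by rewrite eb addn0 addn1 => ->.
  rewrite addn0 => <-; have [wsg|wsg] := boolP (w \in sg); last first.
    have H v : supp v \subset sg -> v w = 0 :> nat.
      move=> vs; apply/eqP; rewrite -leqn0 leqNgt -mem_supp.
      by apply: contra wsg; exact: (subsetP vs).
    by rewrite !H.
  have /cards1P[c ec] : #|sg :\ a :\ b| == 1.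
    have := cardsD1 a sg; have := cardsD1 b (sg :\ a).
    rewrite (K3 sK) asg !inE bsg eq_sym ab /= !add1n => H1 [H2].
    by move: H1; rewrite -H2 => -[<-].
  have wc : w = c by apply/set1P; rewrite -ec !inE wb wa.
  have sum v : supp v \subset sg -> weight v = v a + (v b + v w).
    move=> vs; rewrite (weight_supp vs) (big_setD1 a) //= (big_setD1 b) ?inE ?bsg 1?eq_sym ?ab //=.
    by rewrite ec big_set1 wc.
  move: ea eb (sum x xs) (sum y ys) (etrans xn (esym yn)); clear => ea eb -> ->.
  by rewrite ea eb; lia.
apply/side_adjP; split=> //; exists (up sg z).
  by apply: up_in_lattice => //; apply: subset_trans xs; rewrite (supp_step zx) subsetUr.
by rewrite (mem_up asg zx) (mem_up bsg zy).
Qed.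

(** The first term counts upward triangles, found by subtracting a unit from [x]; the second counts
    downward ones, whose top point must have full support. *)
Lemma star_bound x : weight x = n.+1 ->
  #|[set t : {set V} in F | x \in t]| <=
  \sum_(sg in K2 | supp x \subset sg) (#|supp x| + #|[set i in sg | sg \subset i |: supp x]|).
Proof.
move=> xn.
have [zf Hz] : exists f : W -> V, forall a, a \in supp x -> step a (f a) x.
  apply: (fin_all_exists (P := fun a u => a \in supp x -> step a u x)) => a.
  by case: (boolP (a \in supp x)) => [/step_down[z]|_]; [exists z|exists x].
have [yf Hy] := fin_all_exists (fun a => step_up a (eq_leq xn)).
pose star sg := (fun i => up sg (zf i)) @: supp x :|:
   (fun i => down sg (yf i)) @: [set i in sg | sg \subset i |: supp x].
apply: (@leq_trans (\sum_(sg in K2 | supp x \subset sg) #|star sg|)); last first.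
  apply: leq_sum => sg _; apply: leq_trans (leq_card_setU _ _).1 _.
  by apply: leq_add; exact: leq_imset_card.
apply: leq_trans (leq_card_bigcup_sum _ _); apply/subset_leq_card/subsetP => t.
rewrite inE => /andP[/latticeP[sg sK [z H]] xt].
case: H => -[zn zs et]; rewrite et in xt *.
  case/upP: xt => i isg zx; have sx := supp_step zx.
  have ix : i \in supp x by rewrite sx setU11.
  apply/bigcupP; exists sg; first by rewrite sK sx subUset sub1set isg.
  by rewrite inE (step_inj_base zx (Hz i ix)); apply/orP; left; exact: imset_f.
case/downP: xt => i isg xz; have sz := supp_step xz; rewrite zs in sz.
apply/bigcupP; exists sg; first by rewrite sK sz subsetUr.
rewrite inE (step_inj_tip xz (Hy i)); apply/orP; right; apply: imset_f.
by rewrite inE isg -sz subxx.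
Qed.

Definition corner a := mkpoint (fun w => (w == a) * n.+1).

Lemma cornerE a w : corner a w = (w == a) * n.+1 :> nat.
Proof. by rewrite mkpointE //; case: (w == a); rewrite ?mul1n. Qed.

Lemma weight_corner a : weight (corner a) = n.+1.
Proof.
rewrite /weight (bigD1 a) //= cornerE eqxx mul1n big1 ?addn0 // => w wa.
by rewrite cornerE (negPf wa).
Qed.

Lemma supp_corner a : supp (corner a) = [set a].
Proof. by apply/setP => w; rewrite mem_supp cornerE inE; case: eqP. Qed.

Lemma supp1_corner x a : weight x = n.+1 -> supp x = [set a] -> x = corner a.
Proof.
move=> xn xa; have := @weight_supp x [set a]; rewrite xa subxx xn big_set1 => /(_ isT) ea.
apply: lattice_ext => w; rewrite cornerE; case: eqP => [->|/eqP wa]; first by rewrite -ea mul1n.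
by apply/eqP; rewrite -leqn0 leqNgt -mem_supp xa inE.
Qed.

Lemma star_corner a : #|[set t : {set V} in F | corner a \in t]| <=
  #|[set sg : {set W} in K2 | a \in sg]|.
Proof.
apply: leq_trans (star_bound (weight_corner a)) _; rewrite supp_corner cards1 -[X in _ <= X]sum1_card.
rewrite big_mkcondr [X in _ <= X](eq_bigl (fun sg => (sg \in K2) && (a \in sg))); last by move=> sg; rewrite inE.
rewrite [X in _ <= X]big_mkcondr; apply: leq_sum => sg sK; rewrite sub1set.
case: ifP => // _; rewrite (_ : [set _ in _ | _] = set0) ?cards0 //.
apply/setP => i; rewrite !inE; apply/negP => /andP[_ /subset_leq_card].
by rewrite K3 // cards2; case: (_ != _).
Qed.

(** On a coarse side two coarse triangles contribute [2 + 1] each; in an interior a single one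
    contributes [3 + 3]. *)
Lemma star_generic x : x \in cover F -> #|supp x| != 1 ->
  #|[set t : {set V} in F | x \in t]| <= 6.
Proof.
move=> /coverP[xn [sg0 s0K xs0]] x1; apply: leq_trans (star_bound xn) _.
have x3 : #|supp x| <= 3 by rewrite -(K3 s0K) subset_leq_card.
have x0 : 0 < #|supp x|.
  rewrite card_gt0; apply/eqP => e; move: xn; rewrite (@weight_supp x set0) ?e //.
  by rewrite big_set0.
have [e2|e3] : #|supp x| = 2 \/ #|supp x| = 3 by move: x1 x3 x0; clear; lia.
  have xK : supp x \in sides K2 by rewrite inE e2 eqxx; apply/exists_inP; exists sg0.
  have [_ K22 _] := surfK; have := K22 _ xK.
  rewrite -sum1_card (eq_bigl (fun sg => (sg \in K2) && (supp x \subset sg))); last by move=> sg; rewrite inE.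
  move=> c2; apply: (@leq_trans (\sum_(sg in K2 | supp x \subset sg) 1 * 3)); last first.
    by rewrite -big_distrl /= c2.
  apply: leq_sum => sg /andP[sK xs].
  rewrite mul1n e2 leq_add2l; apply: leq_trans (_ : #|sg :\: supp x| <= 1); last first.
    have := cardsID (supp x) sg; rewrite (setIidPr xs) e2 (K3 sK) => /eqP.
    by rewrite -[3]/(2 + 1) eqn_add2l => /eqP->.
  apply/subset_leq_card/subsetP => i /setIdP[isg si]; rewrite inE isg andbT.
  apply/negP => ix; move: si; rewrite (setUidPr _) ?sub1set // => /subset_leq_card.
  by rewrite K3 // e2.
rewrite (big_pred1 sg0) => [|sg].
  rewrite e3 -[6]/(3 + 3) leq_add2l; apply: leq_trans (_ : #|sg0| <= _); last by rewrite K3.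
  by apply/subset_leq_card/subsetP => i /setIdP[].
apply/andP/eqP => [[sK xs]|->] //.
have e sg' : sg' \in K2 -> supp x \subset sg' -> supp x = sg'.
  by move=> s'K xs'; apply/eqP; rewrite eqEcard xs' e3 K3.
by rewrite -(e sg) // (e sg0).
Qed.

Lemma corner_cover a : a \in cover K2 -> corner a \in cover F.
Proof.
case/bigcupP => sg sK asg; apply/coverP; split; first exact: weight_corner.
by exists sg; rewrite // supp_corner sub1set.
Qed.

(* Total curvature: only the corners can have degree other than six. *)
Lemma lattice_degree_count : 3 * #|F| + 6 * #|cover K2| <= 6 * #|cover F| + 3 * #|K2|.
Proof.
rewrite -(sum_vertex_degrees surfK).
have sumF : \sum_(x in cover F) #|[set t : {set V} in F | x \in t]| = 3 * #|F|.
  under eq_bigr do rewrite -sum1_card.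
  rewrite (exchange_big_dep (mem F)) /=; last by move=> x t _; rewrite inE => /andP[].
  rewrite mulnC -sum_nat_const; apply: eq_bigr => t tF; rewrite -(lattice_card tF) -[RHS]sum1_card.
  apply: eq_bigl => x; rewrite inE tF /=; apply: andb_idl => xt.
  by apply/bigcupP; exists t.
pose C := corner @: cover K2.
have corner_inj : injective corner.
  by move=> a b /(congr1 supp); rewrite !supp_corner; exact: set1_inj.
have CF : C \subset cover F by apply/subsetP => _ /imsetP[a aK ->]; exact: corner_cover.
rewrite -sumF (big_setID C) /= (setIidPr CF) big_imset /=; last by move=> a b _ _; exact: corner_inj.
have -> : 6 * #|cover F| = 6 * #|cover F :\: C| + 6 * #|cover K2|.
  by rewrite -(cardsID C (cover F)) (setIidPr CF) (card_imset _ corner_inj) mulnDr addnC.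
have aux : forall p q r k l, p <= l -> q <= k -> p + q + r <= k + r + l by clear; lia.
apply: aux; first by apply: leq_sum => a _; exact: star_corner.
rewrite mulnC -sum_nat_const; apply: leq_sum => x /setDP[xF xC].
apply: star_generic => //; apply: contra xC => /cards1P[a xa].
have [xn [sg sK xs]] := coverP _ xF; apply/imsetP; exists a; last exact: supp1_corner.
by apply/bigcupP; exists sg => //; rewrite -sub1set -xa.
Qed.

Lemma third_vertex sg a c : sg \in K2 -> a \in sg -> c \in sg -> a != c ->
  exists b, [/\ b \in sg, b != a, b != c & sg = c |: (b |: [set a])].
Proof.
move=> sK asg csg ac.
have /cards1P[b eb] : #|sg :\ a :\ c| == 1.
  have := cardsD1 a sg; have := cardsD1 c (sg :\ a).
  rewrite (K3 sK) asg !inE csg eq_sym ac /= !add1n => H1 [H2].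
  by move: H1; rewrite -H2 => -[<-].
have : b \in sg :\ a :\ c by rewrite eb set11.
rewrite !inE => /and3P[bc ba bsg]; exists b; split=> //.
rewrite -eb; apply/setP => w; rewrite !inE; case: eqP => [->|_]; first by rewrite csg.
by case: eqP => [->|_]; rewrite ?asg ?orbF.
Qed.

(** * Dual connectivity of the subdivision *)

Section DualConnected.
Variable Phi : {set {set V}}.
Hypotheses (PhiF : Phi \subset F)
  (closed : forall s t t' : {set V}, s \in sides F -> t \in cofaces F s ->
     t' \in cofaces F s -> t \in Phi -> t' \in Phi).

Lemma share_edge t t' x y : t \in F -> t' \in F -> x != y ->
  x \in t -> y \in t -> x \in t' -> y \in t' -> (t \in Phi) = (t' \in Phi).
Proof.
move=> tF t'F xy xt yt xt' yt'.
have sF : [set x; y] \in sides F.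
  by rewrite inE cards2 xy; apply/exists_inP; exists t; rewrite // subUset !sub1set xt.
have ct : t \in cofaces F [set x; y] by rewrite inE tF subUset !sub1set xt.
have ct' : t' \in cofaces F [set x; y] by rewrite inE t'F subUset !sub1set xt'.
by apply/idP/idP; apply: closed sF _ _.
Qed.

Lemma up_down sg b c z x y : sg \in K2 -> b \in sg -> c \in sg -> b != c ->
  step b z x -> step c x y -> weight y = n.+2 -> supp y = sg ->
  (up sg z \in Phi) = (down sg y \in Phi).
Proof.
move=> sK bsg csg bc zx xy yn ys; have [x' zx' x'y] := step_commute zx xy.
have xn : weight x = n.+1 by have := weight_step xy; rewrite yn => -[].
have zn : weight z = n by have := weight_step zx; rewrite xn => -[].
apply: (@share_edge _ _ x x').
- apply: up_in_lattice => //; rewrite -ys (supp_step xy) (supp_step zx).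
  by rewrite setUA subsetUr.
- exact: down_in_lattice.
- by apply: contraNneq bc => e; rewrite e in zx; rewrite (step_inj_dir zx zx').
- exact: mem_up zx.
- exact: mem_up zx'.
- exact: mem_down xy.
- exact: mem_down x'y.
Qed.

(** Both upward triangles border the downward triangle whose top is [m] plus a unit in each of the
    three directions. *)
Lemma exchange sg a c m z z' : sg \in K2 -> a \in sg -> c \in sg -> a != c ->
  supp m \subset sg -> step a m z -> step c m z' -> weight z = n ->
  (up sg z \in Phi) = (up sg z' \in Phi).
Proof.
move=> sK asg csg ac ms mz mz' zn; have [b [bsg ba bc esg]] := third_vertex sK asg csg ac.
have [x zx] := step_up b (leq_trans (eq_leq zn) (leqnSn n)).
have xn : weight x = n.+1 by rewrite (weight_step zx) zn.
have [y xy] := step_up c (eq_leq xn).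
have yn : weight y = n.+2 by rewrite (weight_step xy) xn.
have z'n : weight z' = n by rewrite (weight_step mz') -(weight_step mz).
have [x' z'x'] := step_up b (leq_trans (eq_leq z'n) (leqnSn n)).
have x'y : step a x' y.
  apply/stepP => w; move: mz mz' zx xy z'x'.
  move=> /stepP/(_ w) A /stepP/(_ w) B /stepP/(_ w) C /stepP/(_ w) D /stepP/(_ w) E.
  by rewrite D C A E B; clear; lia.
have ys : supp y = sg.
  rewrite (supp_step xy) (supp_step zx) (supp_step mz); apply/eqP; rewrite eqEsubset.
  rewrite !subUset !sub1set asg bsg csg ms /= {1}esg !subUset !sub1set !inE !eqxx ?orbT //.
by rewrite (up_down sK bsg csg bc zx xy yn ys) -(up_down sK bsg asg ba z'x' x'y yn ys).
Qed.

Definition apex a := mkpoint (fun w => (w == a) * n).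

Lemma apexE a w : apex a w = (w == a) * n :> nat.
Proof. by rewrite mkpointE //; case: (w == a); rewrite ?mul1n //; lia. Qed.

Lemma weight_apex a : weight (apex a) = n.
Proof.
rewrite /weight (bigD1 a) //= apexE eqxx mul1n big1 ?addn0 // => w wa.
by rewrite apexE (negPf wa).
Qed.

Lemma supp_apex a sg : a \in sg -> supp (apex a) \subset sg.
Proof.
move=> asg; apply/subsetP => w; rewrite mem_supp apexE.
by case: eqP => [->|].
Qed.

(** Units are moved to [a] one at a time until all the weight sits there. *)
Lemma up_apex sg a z : sg \in K2 -> a \in sg -> weight z = n -> supp z \subset sg ->
  (up sg z \in Phi) = (up sg (apex a) \in Phi).
Proof.
move=> sK asg; have [k] := ubnP (n - z a); elim: k z => // k IHk z lt zn zs.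
have [/existsP[c /andP[ca cz]]|/existsPn H] := boolP [exists c, (c != a) && (c \in supp z)].
  have csg := subsetP zs _ cz; have [m mz] := step_down cz.
  have mn : (weight m).+1 = n by rewrite -(weight_step mz).
  have ms : supp m \subset sg by apply: subset_trans zs; rewrite (supp_step mz) subsetUr.
  have [|z' mz'] := @step_up a m; first by move: mn; clear; lia.
  have z'n : weight z' = n by rewrite (weight_step mz').
  rewrite (exchange sK csg asg ca ms mz mz' zn); apply: IHk => //; last first.
    by rewrite (supp_step mz') subUset sub1set asg.
  have := stepP _ _ _ mz' a; have := stepP _ _ _ mz a; rewrite eq_sym (negPf ca) eqxx.
  have := le_weight z' a; move: lt; rewrite z'n; clear; lia.
have -> : z = apex a; last by [].
have z0 w : w != a -> z w = 0 :> nat.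
  by move=> wa; apply/eqP; have := H w; rewrite wa mem_supp -leqNgt leqn0.
apply: lattice_ext => w; rewrite apexE; have [->|wa] := eqVneq w a; last exact: z0.
by rewrite mul1n -[RHS]zn /weight (bigD1 a) //= big1 ?addn0.
Qed.

Lemma whole_triangle sg a t : sg \in K2 -> a \in sg ->
  (exists z, [/\ weight z = n, supp z \subset sg & t = up sg z] \/
    [/\ weight z = n.+2, supp z = sg & t = down sg z]) ->
  (t \in Phi) = (up sg (apex a) \in Phi).
Proof.
move=> sK asg [z [[zn zs ->]|[zn zs ->]]]; first exact: up_apex.
have /card_gt1P[b [c [bsg csg bc]]] : 1 < #|sg| by rewrite K3.
have [|x xz] := @step_down c z; first by rewrite zs.
have [|m mx] := @step_down b x.
  have : b \in supp z by rewrite zs.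
  by rewrite (supp_step xz) !inE (negPf bc).
rewrite -(up_down sK bsg csg bc mx xz zn zs); apply: up_apex => //.
  by have := weight_step xz; rewrite zn (weight_step mx) => -[].
by rewrite -zs (supp_step xz) (supp_step mx) setUA subsetUr.
Qed.

(** Small triangles of one coarse triangle belong to [Phi] together, so [Phi] induces a family [Psi]
    of coarse triangles. It is closed because coarse neighbors share a small side at a common
    corner. *)
Lemma dual_connected : Phi != set0 -> Phi = F.
Proof.
case/set0Pn => t0 t0P; have /latticeP[sg0 s0K H0] := subsetP PhiF _ t0P.
pose Psi := [set sg : {set W} in K2 | [forall a in sg, up sg (apex a) \in Phi]].
have indep sg a a' : sg \in K2 -> a \in sg -> a' \in sg ->
    (up sg (apex a) \in Phi) = (up sg (apex a') \in Phi).
  move=> sK asg a'sg; apply: up_apex => //; first exact: weight_apex.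
  exact: supp_apex.
have PsiE sg a : sg \in K2 -> a \in sg -> (sg \in Psi) = (up sg (apex a) \in Phi).
  move=> sK asg; rewrite inE sK /=; apply/forall_inP/idP => [/(_ a asg)//|H a' a'sg].
  by rewrite -(indep sg a a').
have eK : Psi = K2.
  have [_ _ K2conn] := surfK; apply: K2conn.
  - by apply/subsetP => sg /setIdP[].
  - have /card_gt0P[a asg] : 0 < #|sg0| by rewrite K3.
    apply/set0Pn; exists sg0; rewrite (PsiE sg0 a) //.
    by rewrite -(whole_triangle s0K asg H0).
  move=> s sg sg'; rewrite inE => /andP[/cards2P[a [b [ab ->]]] _].
  rewrite !inE !subUset !sub1set => /and3P[sK as_ bs] /and3P[s'K as' bs'].
  have := PsiE sg a sK as_; have := PsiE sg' a s'K as'; rewrite !inE => -> ->.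
  have an := weight_apex a.
  have [x ax] := step_up a (leq_trans (eq_leq an) (leqnSn n)).
  have [y ay] := step_up b (leq_trans (eq_leq an) (leqnSn n)).
  rewrite (@share_edge (up sg (apex a)) (up sg' (apex a)) x y) //.
  - by apply: up_in_lattice => //; exact: supp_apex.
  - by apply: up_in_lattice => //; exact: supp_apex.
  - by apply: contraNneq ab => e; rewrite e in ax; rewrite (step_inj_dir ax ay).
  - exact: mem_up ax.
  - exact: mem_up ay.
  - exact: mem_up ax.
  - exact: mem_up ay.
apply/eqP; rewrite eqEsubset PhiF; apply/subsetP => t /latticeP[sg sK H].
have /card_gt0P[a asg] : 0 < #|sg| by rewrite K3.
by rewrite (whole_triangle sK asg H) -PsiE // eK.
Qed.

End DualConnected.

Lemma lattice_surface : closed_pseudosurface F.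
Proof.
split; [exact: lattice_card|exact: lattice_cofaces|].
by move=> Phi PhiF Phi0 closed; exact: dual_connected.
Qed.

(** Twice the sides is three times the triangles, so the Euler characteristic is vertices minus half
    the triangles; the degree count says that subdividing does not lower it. *)
Lemma lattice_euler g : #|sides K2| + 2 <= #|cover K2| + #|K2| + g ->
  #|sides F| + 2 <= #|cover F| + #|F| + g.
Proof.
have := card_sides surfK; have := card_sides lattice_surface; have := lattice_degree_count.
clear; lia.
Qed.

End Lattice.

(** * Topology *)

Require Import Defs.
From mathcomp Require Import all_boot all_order all_algebra.
From mathcomp Require Import all_classical all_reals.
From mathcomp Require Import topology normedtype.
From mathcomp Require Import ring lra.

Import Order.TTheory GRing.Theory Num.Theory.
Import numFieldNormedType.Exports.

Local Open Scope classical_set_scope.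
Local Open Scope ring_scope.

Lemma within_comp (X Y Z : topologicalType) (A : set X) (D : set Y) (f : X -> Y) (h : Y -> Z) :
  {within A, continuous f} -> (forall x, A x -> D (f x)) ->
  {within D, continuous h} -> {within A, continuous (h \o f)}.
Proof.
move=> /subspace_continuousP cf AD /subspace_continuousP ch.
apply/subspace_continuousP => x Ax P /(ch (f x) (AD x Ax)) hP.
have H : \forall y \near x, A y -> D (f y) -> P (h (f y)) := cf x Ax _ hP.
have H' : \forall y \near x, A y -> P (h (f y)).
  by apply: filterS H => y + Ay; apply => //; exact: AD.
exact: H'.
Qed.

Lemma continuous_row (X : topologicalType) (R : realType) m (f : X -> 'rV[R]_m) :
  (forall j, continuous (fun x => f x 0 j)) -> continuous f.
Proof.
move=> cf x P [Q HQ QP]; suff H : \forall y \near x, forall i j, Q i j (f y i j) by apply: filterS H => y; exact: QP.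
have H j : \forall y \near x, Q 0 j (f y 0 j) := cf j x _ (HQ 0 j).
have H2 : \forall y \near x, forall j, Q 0 j (f y 0 j).
  exact: (@filter_forall _ _ (fun j y => Q 0 j (f y 0 j)) (nbhs x) _ H).
by apply: filterS H2 => y Hy i j; rewrite (ord1 i).
Qed.

Lemma continuous_affine (R : realType) m (a b : 'rV[R]_m) :
  continuous (fun t : R => (1 - t) *: a + t *: b).
Proof.
apply: continuous_row => j t; under eq_fun do rewrite !mxE.
apply: cvgD; apply: cvgM; [|exact: cvg_cst|exact: cvg_id|exact: cvg_cst].
by apply: cvgB; [exact: cvg_cst|exact: cvg_id].
Qed.

Lemma near_coord (R : realType) m (y : 'rV[R]_m) j (d : R) : 0 < d ->
  \forall y' \near y, `|y 0 j - (y' : 'rV[R]_m) 0 j| < d.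
Proof.
move=> d0; have := @coord_continuous R 1 m 0 j y _ (nbhsx_ballx (y 0 j) d d0).
by rewrite -ball_normE.
Qed.

(** A coordinate separating two points still separates their neighborhoods; compactness, used for
    one set at a time, makes this uniform. The constant 2 is a scaled distance that two points close
    to a common lattice vertex cannot reach. *)
Lemma compacts_apart (R : realType) m (C C' : set 'rV[R]_m) :
  compact C -> compact C' -> (forall x, C x -> C' x -> False) ->
  \forall n \near \oo, forall x y : 'rV[R]_m, C x -> C' y ->
    exists j, 2 <= n.+1%:R * `|x 0 j - y 0 j|.
Proof.
move=> /compact_near_coveringP cC /compact_near_coveringP cC' dis.
pose far (n : nat) (x y : 'rV[R]_m) := exists j, 2 <= n.+1%:R * `|x 0 j - y 0 j|.
suff : \forall n \near \oo, C `<=` (fun x => forall y, C' y -> far n x y).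
  by apply: filterS => n H x y Cx; exact: H.
apply: cC => x Cx.
suff : \forall p \near filter_prod (nbhs x) \oo, C' `<=` far p.2 p.1 by apply.
apply: cC' => y C'y.
have [j xy] : exists j, x 0 j != y 0 j.
  apply: contrapT => /forallNP H; apply: (dis x) => //; rewrite (_ : x = y) //.
  by apply/rowP => j; apply/eqP/negPn/negP; exact: H.
pose d := `|x 0 j - y 0 j| / 3.
have d0 : 0 < d by rewrite divr_gt0 // normr_gt0 subr_eq0.
exists ([set y' : 'rV[R]_m | `|y 0 j - y' 0 j| < d],
  [set p : 'rV[R]_m * nat | `|x 0 j - p.1 0 j| < d /\ 2 / d <= p.2%:R]) => /=.
  split; first exact: near_coord.
  exists ([set x' : 'rV[R]_m | `|x 0 j - x' 0 j| < d], [set n | 2 / d <= n%:R]) => /=.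
    by split; [exact: near_coord|exact: nbhs_infty_ger].
  by move=> [x' n] [].
move=> [y' [x' n]] /= [yd [xd nd]]; exists j.
have far_d : d <= `|x' 0 j - y' 0 j|.
  have e : `|x 0 j - y 0 j| = 3 * d by rewrite /d; lra.
  have := ler_normD (x 0 j - x' 0 j) (x' 0 j - y' 0 j + (y' 0 j - y 0 j)).
  have := ler_normD (x' 0 j - y' 0 j) (y' 0 j - y 0 j).
  rewrite addrA subrK addrA subrK e (distrC (y' 0 j)); move: xd yd; lra.
rewrite (@le_trans _ _ (n.+1%:R * d)) // ?ler_pM2l ?ltr0n //.
by rewrite -ler_pdivrMr // (le_trans nd) // ler_nat.
Qed.

(** Rounding entries separately would spoil the sum. Increments of the floors of the partial sums
    telescope, and each stays within one of its entry. *)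
Lemma rounding (R : realType) m (r : 'I_m -> R) (N : nat) : (forall j, 0 <= r j) ->
  \sum_j r j = N%:R -> exists x : 'I_m -> nat,
    (\sum_j x j)%N = N /\ forall j, `|r j - (x j)%:R| < 1.
Proof.
move=> r0 rN.
pose r' k := if insub k is Some j then r j else 0.
have r'E (j : 'I_m) : r' j = r j by rewrite /r' valK.
pose S k := \sum_(0 <= i < k) r' i.
have r'0 k : 0 <= r' k by rewrite /r'; case: insub.
have SS k : S k.+1 = S k + r' k by rewrite /S big_nat_recr.
have S0 k : 0 <= S k by apply: sumr_ge0.
have Sm : S m = N%:R.
  by rewrite /S big_mkord -rN; apply: eq_bigr => j _; rewrite r'E.
pose f k := Num.truncn (S k).
have fle k : (f k <= f k.+1)%N by apply: le_truncn; rewrite SS lerDl.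
exists (fun j => f j.+1 - f j)%N; split=> [|j].
  rewrite -(big_mkord predT (fun j => f j.+1 - f j)%N) telescope_sumn //; last first.
    by apply: (homo_leq leqnn _ fle) => x y z; exact: leq_trans.
  by rewrite /f Sm natrK /S big_geq // truncn0 subn0.
have /andP[a1 a2] := truncn_itv (S0 j); have /andP[b1 b2] := truncn_itv (S0 j.+1).
rewrite -r'E natrB // ltr_norml; move: a1 a2 b1 b2; rewrite -/(f j) -/(f j.+1) SS -!natr1.
by move=> a1 a2 b1 b2; apply/andP; split; lra.
Qed.

(** * Thickening a subset to the lattice vertices whose stars it meets *)

Section Trace.
Variables (R : realType) (W : finType) (K : {set {set W}}) (n : nat).
Local Notation K2 := (simplices K 2).
Hypothesis surfK : closed_pseudosurface K2.
Hypothesis Kpure : forall s, s \in K -> exists2 t, t \in K2 & s \subset t.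
Local Notation V := {ffun W -> 'I_n.+3}.
Local Notation F := (lattice_triangles K2 n).
Implicit Types (p : 'rV[R]_#|W|) (C : set 'rV[R]_#|W|) (x y : V).

(* In scaled barycentric coordinates the open star of the lattice vertex x is the
   hexagon of points differing from x by less than 1 in every coordinate. *)
Definition close x p := forall w, `|n.+1%:R * p 0 (enum_rank w) - (x w)%:R| < 1.

Definition trace C : {set V} :=
  [set x : V | (weight x == n.+1) && `[< exists2 p, C p & close x p >]]%SET.

Lemma traceP C x : reflect (weight x = n.+1 /\ exists2 p, C p & close x p) (x \in trace C).
Proof.
rewrite inE; apply: (iffP andP) => [[/eqP xn /asboolP H]|[-> H]] //.
by rewrite eqxx; split=> //; apply/asboolP.
Qed.

Lemma close_supp x p : close x p -> {subset supp x <= [set w | p 0 (enum_rank w) != 0]%SET}.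
Proof.
move=> xp w; rewrite mem_supp inE => xw; apply: contraTneq (xp w) => ->.
by rewrite mulr0 sub0r normrN ger0_norm ?ler0n // -leNgt ler1n.
Qed.

Lemma close_triangle x p : realization R K p -> close x p ->
  exists2 sg, sg \in K2 & forall y, close y p -> supp y \subset sg.
Proof.
move=> [_ _ pK] _; have [sg sK ps] := Kpure pK; exists sg => // y yp.
by apply/fintype.subsetP => w /(close_supp yp) /(fintype.subsetP ps).
Qed.

Lemma trace_cover C : C `<=` realization R K -> trace C \subset finset.cover F.
Proof.
move=> CK; apply/fintype.subsetP => x /traceP[xn [p Cp xp]].
have [sg sK H] := close_triangle (CK p Cp) xp.
by apply/coverP; split=> //; exists sg => //; exact: H.
Qed.

Lemma trace_ex p : realization R K p -> exists2 x, weight x = n.+1 & close x p.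
Proof.
move=> [p0 p1 pK].
have [||f [fn fr]] := @rounding R #|W| (fun j => n.+1%:R * p 0 j) n.+1.
- by move=> j; rewrite mulr_ge0 ?ler0n // -(enum_valK j).
- rewrite -mulr_sumr -[RHS]mulr1 -p1; congr (_ * _).
  by rewrite (reindex (@enum_rank W)) //; apply: onW_bij; exact: enum_rank_bij.
have fle j : (f j <= n.+1)%N by rewrite -fn (bigD1 j) //= leq_addr.
pose x : V := mkpoint n (fun w => f (enum_rank w)).
have xE w : x w = f (enum_rank w) :> nat by rewrite mkpointE // (leq_trans (fle _)).
exists x; last by move=> w; rewrite xE.
rewrite -fn /weight (reindex (@enum_rank W)) /=.
  by apply: eq_bigr => w _; rewrite xE.
by apply: onW_bij; exact: enum_rank_bij.
Qed.

Lemma close_open x : open [set p | close x p].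
Proof.
rewrite openE => p xp.
pose d w := 1 - `|n.+1%:R * p 0 (enum_rank w) - (x w)%:R|.
have d0 w : 0 < d w by rewrite subr_gt0; exact: xp.
suff : \forall q \near p, forall w, `|p 0 (enum_rank w) - (q : 'rV[R]_#|W|) 0 (enum_rank w)| < d w / n.+1%:R.
  apply: filterS => q H w; have := H w; rewrite ltr_pdivlMr ?ltr0n // => Hw.
  have -> : n.+1%:R * q 0 (enum_rank w) - (x w)%:R =
    n.+1%:R * p 0 (enum_rank w) - (x w)%:R - n.+1%:R * (p 0 (enum_rank w) - q 0 (enum_rank w)).
    by rewrite mulrBr; lra.
  apply: le_lt_trans (ler_normB _ _) _; rewrite normrM ger0_norm ?ler0n //.
  by rewrite mulrC in Hw; move: Hw; rewrite /d; lra.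
apply: (@filter_forall _ _ (fun w (q : 'rV[R]_#|W|) => `|p 0 (enum_rank w) - q 0 (enum_rank w)| < d w / n.+1%:R) (nbhs p)) => w.
by apply: near_coord; rewrite divr_gt0 ?ltr0n.
Qed.

Lemma close_near x y p : close x p -> close y p -> forall w, (x w <= (y w).+1)%N.
Proof.
move=> xp yp w; have := xp w; have := yp w; rewrite !ltr_norml => /andP[a b] /andP[c d].
by rewrite -ltnS -(ltr_nat R) -!natr1; move: a b c d; lra.
Qed.

(** Otherwise the stars of the trace vertices inside and outside [S] would split [C] into two open
    parts: they are disjoint on [C] because vertices whose stars share a point are adjacent. *)
Lemma trace_connected C : connected C -> C `<=` realization R K ->
  cut_connected (side_adj F) (trace C).
Proof.
move=> cC CK S [x xC xS] /fintype.subsetPn[y yC yS].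
apply: contrapT => none.
pose near_in := [set p | exists2 z, z \in (trace C :&: S)%SET & close z p].
pose near_out := [set p | exists2 z, z \in (trace C :\: S)%SET & close z p].
have no_both p : C p -> near_in p -> near_out p -> False.
  move=> Cp [z /setIP[/traceP[zn zC] zS] zp] [z' /setDP[/traceP[z'n z'C] z'S] z'p].
  apply: none; exists z, z'; split.
  - by rewrite inE zS andbT; apply/traceP.
  - by rewrite inE z'S; apply/traceP.
  have [sg sK H] := close_triangle (CK p Cp) zp.
  apply: (lattice_adj surfK zn z'n _ sK (H z zp) (H z' z'p)).
    by apply: contraNneq z'S => <-.
  by move=> w; split; exact: close_near.
have cov p : C p -> near_in p \/ near_out p.
  move=> Cp; have [z zn zp] := trace_ex (CK p Cp).
  have zC : z \in trace C by apply/traceP; split=> //; exists p.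
  by have [zS|zS] := boolP (z \in S); [left|right]; exists z; rewrite // inE zC ?zS.
have oin : open near_in.
  rewrite (_ : near_in = \bigcup_(z in [set z | z \in (trace C :&: S)%SET]) [set p | close z p]).
    by apply: bigcup_open => z _; exact: close_open.
  by apply/seteqP; split=> p [z]; exists z.
have oout : open near_out.
  rewrite (_ : near_out = \bigcup_(z in [set z | z \in (trace C :\: S)%SET]) [set p | close z p]).
    by apply: bigcup_open => z _; exact: close_open.
  by apply/seteqP; split=> p [z]; exists z.
have /traceP[_ [p Cp xp]] := xC.
have /traceP[_ [q Cq yq]] := yC.
have xin : x \in (trace C :&: S)%SET by rewrite inE xC.
have yout : y \in (trace C :\: S)%SET by rewrite inE yS.
have E : C `&` near_in = C.
  apply: cC.
  - by exists p; split=> //; exists x.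
  - by exists near_in.
  exists (~` near_out); first exact: open_closedC.
  apply/seteqP; split=> r [Cr Hr]; split=> //; first by move=> H; exact: no_both Hr H.
  by case: (cov r Cr).
have : (C `&` near_in) q by rewrite E.
by move=> [_ qin]; apply: (no_both q Cq qin); exists y.
Qed.

Lemma trace_meet C C' x : x \in trace C -> x \in trace C' ->
  exists p q, [/\ C p, C' q &
    forall w, n.+1%:R * `|p 0 (enum_rank w) - q 0 (enum_rank w)| < 2].
Proof.
move=> /traceP[_ [p Cp xp]] /traceP[_ [q C'q xq]]; exists p, q; split=> // w.
have -> : n.+1%:R * `|p 0 (enum_rank w) - q 0 (enum_rank w)| =
    `|n.+1%:R * p 0 (enum_rank w) - n.+1%:R * q 0 (enum_rank w)|.
  by rewrite -mulrBr normrM ger0_norm ?ler0n.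
have := xp w; have := xq w; rewrite !ltr_norml => /andP[a b] /andP[c d].
by apply/andP; split; move: a b c d; lra.
Qed.

End Trace.

(** * From an embedding to a minor *)

Section EmbeddedGraph.
Variables (R : realType) (W : finType) (K : {set {set W}}).
Local Notation K2 := (simplices K 2).
Hypothesis surfK : closed_pseudosurface K2.
Hypothesis Kpure : forall s, s \in K -> exists2 t, t \in K2 & s \subset t.
Variables (T : finType) (e : rel T).
Hypotheses (e_sym : symmetric e) (e_irr : irreflexive e).
Local Notation G := (realization R (graph_complex e)).
Variable phi : 'rV[R]_#|T| -> 'rV[R]_#|W|.
Hypotheses (phi_cont : {within G, continuous phi})
  (phiK : forall x, G x -> realization R K (phi x))
  (phi_inj : forall x y, G x -> G y -> phi x = phi y -> x = y).
Implicit Types (u v w : T) (t : R).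

Definition edge_point u v t : 'rV[R]_#|T| :=
  (1 - t) *: delta_mx 0 (enum_rank u) + t *: delta_mx 0 (enum_rank v).

Lemma edge_pointE u v t w : edge_point u v t 0 (enum_rank w) =
  (1 - t) * (w == u)%:R + t * (w == v)%:R.
Proof. by rewrite !mxE eqxx !(inj_eq enum_rank_inj). Qed.

Lemma edge_point_sym u v t : edge_point u v (1 - t) = edge_point v u t.
Proof. by rewrite /edge_point subKr addrC. Qed.

(** The degenerate case [u == v] provides a piece even for isolated vertices. *)
Lemma edge_point_in u v t : (u == v) || e u v -> 0 <= t <= 1 -> G (edge_point u v t).
Proof.
move=> uv /andP[t0 t1]; have t1' : 0 <= 1 - t by rewrite subr_ge0.
split.
- by move=> w; rewrite edge_pointE addr_ge0 // mulr_ge0 ?ler0n.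
- under eq_bigr do rewrite edge_pointE.
  rewrite big_split /= -!mulr_sumr.
  have one a : \sum_w (w == a)%:R = 1 :> R.
    by rewrite (bigD1 a) //= eqxx big1 ?addr0 // => w /negPf->.
  by rewrite !one !mulr1 subrK.
rewrite inE; apply/orP.
have suppE w : (w \in [set w | edge_point u v t 0 (enum_rank w) != 0]%SET) =
    ((1 - t) * (w == u)%:R + t * (w == v)%:R != 0) by rewrite inE edge_pointE.
have [tz|tn0] := eqVneq t 0.
  left; apply/existsP; exists u; apply/eqP/setP => w; rewrite suppE inE tz.
  by rewrite subr0 mul1r mul0r addr0 pnatr_eq0 eqb0 negbK.
have [to|tn1] := eqVneq t 1.
  left; apply/existsP; exists v; apply/eqP/setP => w; rewrite suppE inE to.
  by rewrite subrr mul1r mul0r add0r pnatr_eq0 eqb0 negbK.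
have [euv|nuv] := eqVneq u v.
  left; apply/existsP; exists v; apply/eqP/setP => w; rewrite suppE inE euv.
  by rewrite -mulrDl subrK mul1r pnatr_eq0 eqb0 negbK.
right; apply/existsP; exists u; apply/existsP; exists v.
rewrite (negPf nuv) /= in uv; rewrite uv /=; apply/eqP/setP => w; rewrite suppE !inE.
have [->|wu] := eqVneq w u; first by rewrite (negPf nuv) mulr1 mulr0 addr0 subr_eq0 eq_sym tn1.
by rewrite mulr0 add0r mulf_eq0 negb_or tn0 pnatr_eq0 eqb0 negbK.
Qed.

Definition piece (a b : R) u v : set 'rV[R]_#|W| := (phi \o edge_point u v) @` `[a, b].

Section Piece.
Variables (a b : R) (u v : T).
Hypotheses (a0 : 0 <= a) (b1 : b <= 1) (uv : (u == v) || e u v).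

Lemma piece_in t : `[a, b]%classic t -> G (edge_point u v t).
Proof.
rewrite /= in_itv /= => /andP[ta tb]; apply: edge_point_in => //.
by rewrite (le_trans a0 ta) (le_trans tb b1).
Qed.

Lemma piece_cont : {within `[a, b], continuous (phi \o edge_point u v)}.
Proof.
apply: within_comp phi_cont; last exact: piece_in.
by apply: continuous_subspaceT; exact: continuous_affine.
Qed.

Lemma piece_compact : compact (piece a b u v).
Proof. by apply: continuous_compact piece_cont _; exact: segment_compact. Qed.

Lemma piece_connected : connected (piece a b u v).
Proof. by apply: connected_continuous_connected piece_cont; exact: segment_connected. Qed.

Lemma piece_sub : piece a b u v `<=` realization R K.
Proof. by move=> _ [t tab <-]; apply: phiK; exact: piece_in. Qed.

End Piece.

Lemma piece_meet a b a' b' u v u' v' p : 0 <= a -> b <= 1 -> 0 <= a' -> b' <= 1 ->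
  (u == v) || e u v -> (u' == v') || e u' v' -> piece a b u v p -> piece a' b' u' v' p ->
  exists s t, [/\ a <= s <= b, a' <= t <= b' & forall w,
   (1 - s) * (w == u)%:R + s * (w == v)%:R = (1 - t) * (w == u')%:R + t * (w == v')%:R].
Proof.
move=> a0 b1 a'0 b'1 uv uv' [s sab <-] [t tab /= ep].
have es := phi_inj (piece_in a'0 b'1 uv' tab) (piece_in a0 b1 uv sab) ep.
exists s, t; split; first by move: sab; rewrite /= in_itv.
  by move: tab; rewrite /= in_itv.
by move=> w; rewrite -!edge_pointE es.
Qed.

Let third : 0 <= (1 / 3 : R) /\ (1 / 3 : R) <= 1 /\ (2 / 3 : R) <= 1 /\ (1 / 3 : R) <= 2 / 3.
Proof. by split; [lra|split; [lra|split; lra]]. Qed.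

(** Cutting at thirds: on a stub its vertex has coordinate at least 2/3, on a middle both ends have
    at least 1/3. Comparing these coordinates tells which pieces can share a point. *)
Let stub := piece 0 (1 / 3).
Let middle := piece (1 / 3) (2 / 3).

Lemma stubs_disjoint u v u' v' p : (u == v) || e u v -> (u' == v') || e u' v' ->
  stub u v p -> stub u' v' p -> u = u'.
Proof.
move=> uv uv' H H'; have [t1 [t2 [t3 t4]]] := third.
have [s [t [/andP[s0 s1] /andP[t0' t1'] E]]] := piece_meet (lexx 0) t2 (lexx 0) t2 uv uv' H H'.
apply/eqP/negPn/negP => uu; have := E u; rewrite eqxx (negPf uu).
by case: (u == v); case: (u == v') => /=; lra.
Qed.

Lemma middles_disjoint u v u' v' p : e u v -> e u' v' ->
  middle u v p -> middle u' v' p -> [set u; v]%SET = [set u'; v']%SET.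
Proof.
move=> uv uv' H H'; have [t1 [t2 [t3 t4]]] := third.
have uv_ : (u == v) || e u v by rewrite uv orbT.
have uv_' : (u' == v') || e u' v' by rewrite uv' orbT.
have [s [t [/andP[s0 s1] /andP[t0' t1'] E]]] := piece_meet t1 t3 t1 t3 uv_ uv_' H H'.
have nuv : u != v by apply: contraTneq uv => ->; rewrite e_irr.
apply/eqP; rewrite eqEcard finset.subUset !finset.sub1set !cards2 nuv !inE; apply/andP; split; last first.
  by case: (_ != _).
apply/andP; split.
  have := E u; rewrite eqxx (negPf nuv).
  by case: (u == u'); case: (u == v') => //=; lra.
have := E v; rewrite eqxx eq_sym (negPf nuv).
by case: (v == u'); case: (v == v') => //=; lra.
Qed.

Lemma middle_stub u v w w' p : e u v -> (w == w') || e w w' ->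
  middle u v p -> stub w w' p -> w = u \/ w = v.
Proof.
move=> uv ww' H H'; have [t1 [t2 [t3 t4]]] := third.
have uv_ : (u == v) || e u v by rewrite uv orbT.
have [s [t [/andP[s0 s1] /andP[t0' t1'] E]]] := piece_meet t1 t3 (lexx 0) t2 uv_ ww' H H'.
have := E w; rewrite eqxx; case: eqP => [->|_]; first by left.
case: eqP => [->|_]; first by right.
by case: (w == w') => /= ?; exfalso; lra.
Qed.

Lemma pieces_apart : exists n, forall (a a' : bool) u v u' v',
  (if a then e u v else (u == v) || e u v) -> (if a' then e u' v' else (u' == v') || e u' v') ->
  (forall p, (if a then middle else stub) u v p -> (if a' then middle else stub) u' v' p -> False) ->
  forall p q, (if a then middle else stub) u v p -> (if a' then middle else stub) u' v' q ->
    exists j, 2 <= n.+1%:R * `|p 0 j - q 0 j|.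
Proof.
have [t1 [t2 [t3 t4]]] := third.
pose J := (bool * T * T)%type.
pose valid (i : J) := if i.1.1 then e i.1.2 i.2 else (i.1.2 == i.2) || e i.1.2 i.2.
pose pc (i : J) := (if i.1.1 then middle else stub) i.1.2 i.2.
pose ok (ij : J * J) (n : nat) := valid ij.1 -> valid ij.2 ->
  (forall p, pc ij.1 p -> pc ij.2 p -> False) ->
  forall p q : 'rV[R]_#|W|, pc ij.1 p -> pc ij.2 q -> exists j, 2 <= n.+1%:R * `|p 0 j - q 0 j|.
have cpt i : valid i -> compact (pc i).
  case: i => [[[] u] v]; rewrite /valid /pc /= => uv; apply: piece_compact => //.
  by rewrite uv orbT.
have : \forall n \near \oo, forall ij, ok ij n.
  apply: (@filter_forall _ _ ok \oo) => -[i j].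
  have [vi|nvi] := boolP (valid i); last by apply: nearW => n; rewrite /ok /= (negPf nvi).
  have [vj|nvj] := boolP (valid j); last by apply: nearW => n; rewrite /ok /= (negPf nvj).
  have [dis|ndis] := pselect (forall p, pc i p -> pc j p -> False); last by apply: nearW => n _ _ /ndis.
  by apply: filterS (compacts_apart (cpt i vi) (cpt j vj) dis) => n H _ _ _.
case/filter_ex => n Hn; exists n => a a' u v u' v' va va' dis p q.
exact: (Hn ((a, u, v), (a', u', v'))).
Qed.

Lemma embedded_minor_sparse g : (0 < g)%N ->
  (#|sides K2| + 2 <= #|finset.cover K2| + #|K2| + g)%N -> minor_sparse e g.
Proof.
move=> g0 euler; have [t1 [t2 [t3 t4]]] := third.
have [n apart] := pieces_apart.
pose F := lattice_triangles K2 n.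
pose P : pred {ffun W -> 'I_n.+3} := fun x => x \in finset.cover F.
have PE (X : {set {ffun W -> 'I_n.+3}}) : (X \subset P) = (X \subset finset.cover F).
  by apply/fintype.subsetP/fintype.subsetP.
have edge_or u v : e u v -> (u == v) || e u v by move=> ->; rewrite orbT.
(* All stubs at [u] contain the image of [u], so their traces share a lattice vertex and the union
   is connected. *)
pose A u := (\bigcup_(v | (u == v) || e u v) trace n (stub u v))%SET.
pose C u v := trace n (middle u v).
have stub_sub u v : (u == v) || e u v -> stub u v `<=` realization R K by exact: piece_sub.
have mid_sub u v : e u v -> middle u v `<=` realization R K.
  by move=> uv; apply: piece_sub => //; exact: edge_or.
have AP u x : x \in A u -> exists v, ((u == v) || e u v) /\ x \in trace n (stub u v).
  by move=> /finset.bigcupP[v uv xv]; exists v.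
have no_meet a a' u v u' v' x :
    (if a then e u v else (u == v) || e u v) ->
    (if a' then e u' v' else (u' == v') || e u' v') ->
    x \in trace n ((if a then middle else stub) u v) ->
    x \in trace n ((if a' then middle else stub) u' v') ->
    exists p, (if a then middle else stub) u v p /\ (if a' then middle else stub) u' v' p.
  move=> uv uv' xC xC'; apply: contrapT => none.
  have [p [q [Cp C'q pq]]] := trace_meet xC xC'.
  have [|j] := apart a a' u v u' v' uv uv' _ p q Cp C'q.
    by move=> r Cr C'r; apply: none; exists r.
  by have := pq (enum_val j); rewrite enum_valK ltNge => /negP.
have start u v : stub u v (phi (edge_point u u 0)).
  exists 0; first by rewrite /= in_itv /= lexx t1.
  by rewrite /= /edge_point subr0 !scale1r !scale0r.
have [B [BP Bc B0 Bd Be]] : exists B : T -> {set {ffun W -> 'I_n.+3}},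
    [/\ forall u, B u \subset P, forall u, cut_connected (side_adj F) (B u),
      forall u, B u != finset.set0, disjoint_blocks B &
      forall u v, e u v -> exists x y, [/\ x \in B u, y \in B v & side_adj F x y]].
  have common u : exists2 x : {ffun W -> 'I_n.+3}, weight x = n.+1 & close x (phi (edge_point u u 0)).
    apply: trace_ex; apply: phiK; apply: edge_point_in; first by rewrite eqxx.
    by rewrite lexx ler01.
  apply: (minor_model_of_pieces (A := A) (C := C)) => //.
  - exact: side_adj_sym.
  - move=> u; rewrite PE; apply/fintype.subsetP => x /AP[v [uv xv]].
    exact: (fintype.subsetP (trace_cover n Kpure (stub_sub u v uv)) x xv).
  - move=> u; have [x xn xc] := common u.
    apply: (@cut_connected_bigcup _ _ _ _ _ x) => v uv.
      by apply: (trace_connected surfK Kpure); [exact: piece_connected|exact: stub_sub].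
    by apply/traceP; split=> //; exists (phi (edge_point u u 0)).
  - move=> u; have [x xn xc] := common u; apply/set0Pn; exists x.
    apply/finset.bigcupP; exists u; first by rewrite eqxx.
    by apply/traceP; split=> //; exists (phi (edge_point u u 0)).
  - move=> u u' x /AP[v [uv xv]] /AP[v' [uv' xv']].
    have [p [Hp Hp']] := @no_meet false false u v u' v' x uv uv' xv xv'.
    exact: stubs_disjoint uv uv' Hp Hp'.
  - move=> u v uv; have uv_ := edge_or u v uv.
    have vu : e v u by rewrite e_sym.
    have meet w w' q : e w w' -> stub w w' q -> middle u v q -> A w :&: C u v != finset.set0.
      move=> ww' sq mq; have [x xn xc] := trace_ex n (mid_sub u v uv q mq).
      apply/set0Pn; exists x; rewrite inE; apply/andP; split.
        apply/finset.bigcupP; exists w'; first exact: edge_or.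
        by apply/traceP; split=> //; exists q.
      by apply/traceP; split=> //; exists q.
    split.
    + by apply: (trace_connected surfK Kpure); [exact: piece_connected|exact: mid_sub].
    + by rewrite PE; exact: (trace_cover n Kpure (mid_sub u v uv)).
    + apply: (meet u v (phi (edge_point u v (1 / 3)))) => //.
        by exists (1 / 3) => //; rewrite /= in_itv /= t1 lexx.
      by exists (1 / 3) => //; rewrite /= in_itv /= lexx t4.
    + apply: (meet v u (phi (edge_point u v (2 / 3)))) => //.
        exists (1 / 3); first by rewrite /= in_itv /= t1 lexx.
        by rewrite /= -edge_point_sym; congr (phi (edge_point _ _ _)); lra.
      by exists (2 / 3) => //; rewrite /= in_itv /= lexx t4.
  - move=> u v w x uv xC /AP[w' [ww' xw]].
    have [p [Hp Hp']] := @no_meet true false u v w w' x uv ww' xC xw.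
    exact: middle_stub uv ww' Hp Hp'.
  - move=> u v u' v' x uv uv' xC xC'.
    have [p [Hp Hp']] := @no_meet true true u v u' v' x uv uv' xC xC'.
    exact: middles_disjoint uv uv' Hp Hp'.
apply: (minor_sparse_model (P := P) _ BP Bc B0 Bd Be) => I D DP Dc Dd.
apply: surface_minor_bound => //; first exact: lattice_surface.
exact: lattice_euler.
Qed.

End EmbeddedGraph.

(** * The plane without finitely many points *)

Section Plane.
Variable R : realType.
Implicit Types (x y z q : 'rV[R]_2) (k s t : R) (Q : seq 'rV[R]_2).

Lemma upper_bound_seq (l : seq R) : exists k, forall b, b \in l -> b < k.
Proof.
elim: l => [|c l [k Hk]]; first by exists 0.
exists (Num.max (c + 1) k) => b; rewrite inE lt_max => /predU1P[->|/Hk->].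
  by rewrite ltrDl ltr01.
by rewrite orbT.
Qed.

Definition ray x k s : 'rV[R]_2 := \row_j (x 0 j + s * (if j == 0 then 1 else k)).

Definition segment x z := (fun t => (1 - t) *: x + t *: z) @` `[0, 1].

Lemma segment_path_connected x z : connected (segment x z).
Proof.
apply: connected_continuous_connected; first exact: segment_connected.
by apply: continuous_subspaceT; exact: continuous_affine.
Qed.

Lemma segment_l x z : segment x z x.
Proof.
exists 0; first by rewrite /= in_itv /= lexx ler01.
by rewrite subr0 scale1r scale0r addr0.
Qed.

Lemma segment_r x z : segment x z z.
Proof.
exists 1; first by rewrite /= in_itv /= lexx ler01.
by rewrite subrr scale1r scale0r add0r.
Qed.

(** A point of [Q] on the segment, off the vertical through [x], would have slope exactly [k]. On
    that vertical the quotient is 0 by convention, and a segment of finite slope meets the vertical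
    only at [x]. *)
Lemma ray_avoids x k s Q : x \notin Q ->
  (forall q, q \in Q -> (q 0 1 - x 0 1) / (q 0 0 - x 0 0) < k) ->
  segment x (ray x k s) `<=` [set y | y \notin Q].
Proof.
move=> xQ bad _ [t _ <-]; apply/negP => qQ; have := bad _ qQ; rewrite !mxE /=.
set st := t * s; have -> : (1 - t) * x 0 1 + t * (x 0 1 + s * k) - x 0 1 = k * st by rewrite /st; ring.
have -> : (1 - t) * x 0 0 + t * (x 0 0 + s * 1) - x 0 0 = st by rewrite /st; ring.
have [st0|st0] := eqVneq st 0; last by rewrite mulfK // ltxx.
move/negP: xQ => xQ _; apply: xQ; rewrite (_ : x = (1 - t) *: x + t *: ray x k s) //.
apply/rowP => j; rewrite !mxE; set c := (if _ then _ else _).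
have -> : (1 - t) * x 0 j + t * (x 0 j + s * c) = x 0 j + st * c by rewrite /st; ring.
by rewrite st0 mul0r addr0.
Qed.

Lemma plane_minus_finite_connected Q : connected [set x | x \notin Q].
Proof.
have [x0Q|none] := pselect (exists x, x \notin Q); last first.
  rewrite (_ : [set x | x \notin Q] = set0); first exact: connected0.
  by apply/seteqP; split=> // x xQ; apply: none; exists x.
case: x0Q => x xQ.
have join y : y \notin Q -> exists C, [/\ connected C, C `<=` [set z | z \notin Q], C x & C y].
  move=> yQ.
  have [k1 Hk1] := upper_bound_seq [seq ((q : 'rV[R]_2) 0 1 - x 0 1) / (q 0 0 - x 0 0) | q <- Q].
  have [k2 Hk2] := upper_bound_seq (k1 :: [seq ((q : 'rV[R]_2) 0 1 - y 0 1) / (q 0 0 - y 0 0) | q <- Q]).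
  have k12 : k1 < k2 by apply: Hk2; rewrite mem_head.
  have k12' : k1 - k2 != 0 by rewrite subr_eq0 lt_eqF.
  (* The two allowed slopes differ, so the lines through [x] and [y] cross; [s] and [t] are the
     parameters of the crossing. *)
  pose s := ((y 0 1 - x 0 1) - k2 * (y 0 0 - x 0 0)) / (k1 - k2).
  pose t := s - (y 0 0 - x 0 0).
  have ez : ray x k1 s = ray y k2 t.
    apply/rowP => j; rewrite !mxE; case: (ord0 =P j) => [<-|/eqP j0].
      by rewrite eqxx /t; ring.
    have -> : j = 1 by apply/val_inj; case: j j0 => [[|[|]]].
    by rewrite /= /t /s; field.
  exists (segment x (ray x k1 s) `|` segment y (ray y k2 t)); split.
  - apply: connectedU; [|exact: segment_path_connected|exact: segment_path_connected].
    by exists (ray x k1 s); split; [|rewrite ez]; exact: segment_r.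
  - move=> z [|]; apply: ray_avoids => // q qQ; first by apply: Hk1; apply: map_f.
    by apply: Hk2; rewrite inE; apply/orP; right; apply: map_f.
  - by left; exact: segment_l.
  - by right; exact: segment_l.
have [C HC] : exists C : 'rV[R]_2 -> set 'rV[R]_2, forall y, y \notin Q ->
    [/\ connected (C y), C y `<=` [set z | z \notin Q], C y x & C y y].
  have /choice[C HC] : forall y, exists C, y \notin Q ->
      [/\ connected C, C `<=` [set z | z \notin Q], C x & C y].
    by move=> y; have [/join[C HC]|_] := boolP (y \notin Q); [exists C|exists set0].
  by exists C.
rewrite (_ : [set x | x \notin Q] = \bigcup_(y in [set y | y \notin Q]) C y).
  apply: bigcup_connected; last by move=> y /HC[].
  by exists x => y /HC[].
apply/seteqP; split=> [y yQ|y [z /HC[_ Csub _ _]]]; last exact: Csub.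
by exists y => //; have [] := HC y yQ.
Qed.

End Plane.

Lemma near_zero_point (R : realType) (P : set R) : nbhs 0 P ->
  exists2 t, 0 < t < 1 & P t.
Proof.
move=> /nbhs_ballP[d /= d0 dP]; exists (Num.min (d / 2) (1 / 2)).
  by rewrite lt_min gt_min divr_gt0 //=; apply/andP; split; [lra|apply/orP; right; lra].
apply: dP; rewrite -ball_normE /= sub0r normrN ger0_norm; last by rewrite le_min; apply/andP; split; lra.
by rewrite gt_min; apply/orP; left; lra.
Qed.

(** * Dual connectivity of a triangulated surface *)

Section TriangulatedSurface.
Variables (R : realType) (S : topologicalType) (W : finType) (K : {set {set W}}).
Hypotheses (surfS : closed_surface R S) (KS : triangulates R S K).
Local Notation K2 := (simplices K 2).
Let cpxK : closed_2complex K := KS.1.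

Definition carrier (p : 'rV[R]_#|W|) : {set W} := [set w | p 0 (enum_rank w) != 0]%SET.

Lemma mem_K2 t : (t \in K2) = (t \in K) && (#|t| == 3)%N.
Proof. by rewrite inE. Qed.

Lemma sides_simplices : sides K2 = simplices K 1.
Proof.
have [[_ Kdown] Kpure _] := cpxK.
apply/setP => s; rewrite !inE; apply/andP/andP => [[s2 /exists_inP[t]]|[sK s2]].
  rewrite mem_K2 => /andP[tK _] st; split=> //; apply: Kdown st _ => //.
  by rewrite -card_gt0 (eqP s2).
by split=> //; have [t tK st] := Kpure s sK; apply/exists_inP; exists t.
Qed.

Lemma card_cover_simplices : #|finset.cover K2| = #|simplices K 0|.
Proof.
have [[_ Kdown] Kpure _] := cpxK.
rewrite -(card_imset _ (@finset.set1_inj W)); apply: eq_card => s.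
rewrite [in RHS]inE; apply/imsetP/andP => [[a /finset.bigcupP[t]]|[sK /cards1P[a es]]].
  rewrite mem_K2 => /andP[tK _] at_ ->; rewrite cards1; split=> //.
  apply: Kdown tK _ _; first by rewrite finset.sub1set.
  by apply/set0Pn; exists a; rewrite inE.
exists a => //; have [t tK st] := Kpure s sK; apply/finset.bigcupP; exists t => //.
by apply: (fintype.subsetP st); rewrite es inE.
Qed.

Lemma edge_carrier (a b : W) (t : R) : a != b -> 0 < t < 1 ->
  carrier (edge_point a b t) = [set a; b]%SET.
Proof.
move=> ab /andP[t0 t1]; apply/setP => w; rewrite !inE edge_pointE.
have [->|wa] := eqVneq w a; first by rewrite (negPf ab) mulr1 mulr0 addr0 subr_eq0 gt_eqF.
by rewrite mulr0 add0r mulf_eq0 negb_or gt_eqF //= pnatr_eq0 eqb0 negbK.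
Qed.

Lemma vertex_carrier (a b : W) : carrier (edge_point a b 0) = [set a]%SET.
Proof.
apply/setP => w; rewrite !inE edge_pointE subr0 mul1r mul0r addr0.
by rewrite pnatr_eq0 eqb0 negbK.
Qed.

Lemma edge_point_realization (a b : W) (t : R) : 0 <= t <= 1 ->
  carrier (edge_point a b t) \in K -> realization R K (edge_point a b t).
Proof.
by move=> t01 cK; have [|h1 h2 _] := @edge_point_in R W (fun _ _ => true) a b t _ t01; rewrite ?orbT.
Qed.

Lemma sub_in_K (t s : {set W}) : t \in K2 -> s \subset t -> s != finset.set0 -> s \in K.
Proof.
by have [[_ Kdown] _ _] := cpxK; rewrite mem_K2 => /andP[tK _]; exact: Kdown.
Qed.

Lemma carrier_vertex p q a : realization R K p -> realization R K q ->
  carrier p = [set a]%SET -> carrier q = [set a]%SET -> p = q.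
Proof.
have coord p' : realization R K p' -> carrier p' = [set a]%SET ->
    forall w, p' 0 (enum_rank w) = (w == a)%:R.
  move=> [_ s1 _] ca.
  have z w : w != a -> p' 0 (enum_rank w) = 0.
    move=> wa; apply/eqP/negPn/negP => nz; have : w \in carrier p' by rewrite inE.
    by rewrite ca inE (negPf wa).
  move=> w; have [->|wa] := eqVneq w a; last exact: z.
  by move: s1; rewrite (bigD1 a) //= big1 ?addr0 // => v /z.
move=> rp rq cp cq; apply/rowP => j; rewrite -(enum_valK j).
by rewrite (coord p) // (coord q).
Qed.

(* Two sets of triangles that share no side meet only at vertices, whereas a disc
   punctured at finitely many points is connected. *)
Lemma triangulation_dual_connected (Phi : {set {set W}}) :
  Phi \subset K2 -> Phi != finset.set0 ->
  (forall s t t' : {set W}, s \in sides K2 -> t \in cofaces K2 s ->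
     t' \in cofaces K2 s -> t \in Phi -> t' \in Phi) -> Phi = K2.
Proof.
have [_ Kpure _] := cpxK.
have [_ [f [h [[cf ch] fS hK hf fh]]]] := KS.
have {}ch : continuous h by apply/continuous_subspace_setT.
have {}hK y : realization R K (h y) by exact: hK.
have {}fh y : f (h y) = y by exact: fh.
have [S0 _ _ connS local] := surfS.
move=> PK P0 Pclosed; apply: contrapT => PnK.
pose Psi := (K2 :\: Phi)%SET.
have Psi0 : Psi != finset.set0.
  by apply/negP => /eqP e; apply: PnK; apply/eqP; rewrite finset.eqEsubset PK -finset.setD_eq0 -/Psi e eqxx.
pose side (X : {set {set W}}) := [set y : S | exists2 t, t \in X & carrier (h y) \subset t].
(* Nonzero coordinates stay nonzero nearby, so carriers can only grow. *)
have closed_side X : closed (side X).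
  rewrite -openC openE => y yX.
  have : \forall y' \near y, forall w, w \in carrier (h y) -> w \in carrier (h y').
    apply: (@filter_forall _ _ (fun w y' => w \in carrier (h y) -> w \in carrier (h y')) (nbhs y)) => w.
    have [wy|_] := boolP (w \in carrier (h y)); last by apply: nearW.
    have wy0 : 0 < `|h y 0 (enum_rank w)| by rewrite normr_gt0; move: wy; rewrite inE.
    have near_y : \forall y' \near y, `|h y 0 (enum_rank w) - h y' 0 (enum_rank w)| < `|h y 0 (enum_rank w)|.
      exact: (ch y _ (near_coord (h y) (enum_rank w) wy0)).
    apply: filterS near_y => y' H _.
    by rewrite inE; apply: contraTneq H => ->; rewrite subr0 ltxx.
  apply: filterS => y' H [t tX ct]; apply: yX; exists t => //.
  by apply/fintype.subsetP => w /H /(fintype.subsetP ct).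
have cov y : side Phi y \/ side Psi y.
  have [_ _ yK] := hK y; have [t tK ct] := Kpure _ yK.
  by have [tP|tP] := boolP (t \in Phi); [left|right]; exists t; rewrite // inE tP.
(* Two vertices in the carrier would form a side between a triangle of [Phi] and one of [Psi]. *)
have corner y : side Phi y -> side Psi y -> exists a, carrier (h y) = [set a]%SET.
  move=> [t tP ct] [t' /setDP[t'K t'P] ct'].
  have [_ _ yK] := hK y.
  have c0 : (0 < #|carrier (h y)|)%N.
    rewrite card_gt0; apply/eqP => e; have [[K0 _] _ _] := cpxK.
    by move: K0; rewrite -e yK.
  suff c1 : (#|carrier (h y)| <= 1)%N.
    by apply/cards1P; rewrite eqn_leq c1.
  rewrite leqNgt; apply/negP => /card_gt1P[a [b [ay by_ ab]]].
  have sub : [set a; b]%SET \subset carrier (h y) by rewrite finset.subUset !finset.sub1set ay.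
  have tK := fintype.subsetP PK t tP.
  have sideab : [set a; b]%SET \in sides K2.
    rewrite inE cards2 ab; apply/exists_inP; exists t => //.
    exact: fintype.subset_trans sub ct.
  move/negP: t'P; apply; apply: (Pclosed [set a; b]%SET t) => //.
    by rewrite inE tK; exact: fintype.subset_trans sub ct.
  by rewrite inE t'K; exact: fintype.subset_trans sub ct'.
have ne (X : {set {set W}}) : X \subset K2 -> X != finset.set0 -> side X !=set0.
  move=> XK /set0Pn[t tX]; have tK := fintype.subsetP XK t tX.
  have /card_gt0P[a at_] : (0 < #|t|)%N by move: tK; rewrite mem_K2 => /andP[_ /eqP->].
  have aK : [set a]%SET \in K.
    by apply: (sub_in_K tK); rewrite ?finset.sub1set //; apply/set0Pn; exists a; rewrite inE.
  exists (f (edge_point a a 0)), t => //.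
  rewrite hf; first by rewrite vertex_carrier finset.sub1set.
  by apply: edge_point_realization; rewrite ?vertex_carrier // lexx ler01.
have PsiK : Psi \subset K2 by exact: finset.subsetDl.
have [p0 [p0P p0Q]] : exists y, side Phi y /\ side Psi y.
  apply: contrapT => none.
  have eS : side Phi = [set: S].
    apply: connS.
    - exact: ne.
    - exists (~` side Psi); first by rewrite openC; exact: closed_side.
      rewrite setTI; apply/seteqP; split=> y; first by move=> yP yQ; apply: none; exists y.
      by case: (cov y).
    - by exists (side Phi); rewrite ?setTI //; exact: closed_side.
  have [y yQ] := ne Psi PsiK Psi0; apply: none; exists y; split=> //.
  by rewrite eS.
have [a ca] := corner p0 p0P p0Q.
have [U [oU Up0] [psi [xi [[_ cxi] _ xiU xipsi psixi]]]] := local p0.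
pose crn c := f (edge_point c c 0).
(* The chart maps [U] onto the whole plane, so [U] without the vertices of the triangulation is a
   connected set. It meets both parts near [p0], yet they are disjoint on it. *)
pose Q := [seq psi (crn c) | c <- enum W & `[< U (crn c) /\ [set c]%SET \in K >]].
have crn_eq y c : carrier (h y) = [set c]%SET -> y = crn c.
  move=> cy; have rc : realization R K (edge_point c c 0).
    apply: edge_point_realization; rewrite ?vertex_carrier ?lexx ?ler01 //.
    by rewrite -cy; have [] := hK y.
  by rewrite /crn -(carrier_vertex (hK y) rc cy (vertex_carrier c c)) fh.
have connX : connected (xi @` [set z | z \notin Q]).
  apply: connected_continuous_connected; first exact: plane_minus_finite_connected.
  by apply: continuous_subspaceW cxi.
have XU y : (xi @` [set z | z \notin Q]) y -> U y by move=> [z _ <-]; exact: xiU.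
have Xno y : (xi @` [set z | z \notin Q]) y -> side Phi y -> side Psi y -> False.
  move=> Xy yP yQ; have [c cy] := corner y yP yQ; have ey := crn_eq y c cy.
  have Uy := XU y Xy; move: Xy => [z /negP zQ ez]; apply: zQ.
  rewrite -(psixi z I) ez ey; apply: map_f; rewrite mem_filter mem_enum andbT.
  by apply/asboolP; rewrite -ey -cy; split=> //; have [] := hK y.
(* On an edge leaving [a] in a triangle of [X], interior points close to [p0] lie in [U] and are not
   vertices. *)
have meets (X : {set {set W}}) : X \subset K2 -> side X p0 -> exists y, (xi @` [set z | z \notin Q]) y /\ side X y.
  move=> XK [t tX]; rewrite ca finset.sub1set => at_; have tK := fintype.subsetP XK t tX.
  have [b bt ab] : exists2 b, b \in t & a != b.
    have /card_gt1P[b [c [bt ct bc]]] : (1 < #|t|)%N by move: tK; rewrite mem_K2 => /andP[_ /eqP->].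
    by have [eab|] := eqVneq a b; [exists c; rewrite // eab|exists b].
  have aK : [set a]%SET \in K.
    by apply: (sub_in_K tK); rewrite ?finset.sub1set //; apply/set0Pn; exists a; rewrite inE.
  have abK : [set a; b]%SET \in K.
    apply: (sub_in_K tK); first by rewrite finset.subUset !finset.sub1set at_.
    by apply/set0Pn; exists a; rewrite !inE eqxx.
  have inK s : `[0, 1]%classic s -> realization R K (edge_point a b s).
    rewrite /= in_itv /= => s01; apply: edge_point_realization => //.
    have [->|s0] := eqVneq s 0; first by rewrite vertex_carrier.
    have [->|s1] := eqVneq s 1.
      rewrite -(subr0 1) edge_point_sym vertex_carrier.
      apply: (sub_in_K tK); first by rewrite finset.sub1set.
      by apply/set0Pn; exists b; rewrite inE.
    move: s01 => /andP[s0' s1']; rewrite edge_carrier //.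
    by rewrite !lt_neqAle eq_sym s0 s0' s1 s1'.
  have e0 : f (edge_point a b 0) = p0.
    rewrite -(fh p0); congr f; apply: carrier_vertex (hK p0) (vertex_carrier a b) ca.
    by apply: inK; rewrite /= in_itv /= lexx ler01.
  have /subspace_continuousP cpath : {within `[0, 1], continuous (f \o edge_point a b)}.
    apply: within_comp cf; last exact: inK.
    by apply: continuous_subspaceT; exact: continuous_affine.
  have nU : nbhs ((f \o edge_point a b) 0) U by rewrite /= e0; exact: open_nbhs_nbhs.
  have zin : `[0, 1]%classic (0 : R) by rewrite /= in_itv /= lexx ler01.
  have near0 : \forall s \near (0 : R), `[0, 1]%classic s -> U (f (edge_point a b s)) := cpath 0 zin U nU.
  have [s s01 Hs] := near_zero_point near0.
  have sin : `[0, 1]%classic s by move: s01 => /andP[? ?]; rewrite /= in_itv /= !ltW.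
  pose y := f (edge_point a b s); have Uy : U y by exact: Hs.
  have hy : h y = edge_point a b s by rewrite hf //; exact: inK.
  have cy : carrier (h y) = [set a; b]%SET by rewrite hy edge_carrier.
  exists y; split; last by exists t => //; rewrite cy finset.subUset !finset.sub1set at_.
  exists (psi y); last exact: xipsi.
  apply/negP => /mapP[c]; rewrite mem_filter => /andP[/asboolP[Uc cK1] _] ey.
  have eyc : y = crn c by rewrite -(xipsi y Uy) ey xipsi.
  have : (#|carrier (h y)| = 1)%N.
    have cK : realization R K (edge_point c c 0).
      by apply: edge_point_realization; rewrite ?lexx ?ler01 ?vertex_carrier.
    by rewrite eyc hf // vertex_carrier cards1.
  by rewrite cy cards2 ab.
have [y [yX yP]] := meets Phi PK p0P.
have [z [zX zQ]] := meets Psi PsiK p0Q.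
have E : (xi @` [set z | z \notin Q]) `&` side Phi = xi @` [set z | z \notin Q].
  apply: connX.
  - by exists y.
  - exists (~` side Psi); first by rewrite openC; exact: closed_side.
    apply/seteqP; split=> r [rX Hr]; split=> //; first by move=> H; exact: Xno Hr H.
    by case: (cov r).
  - by exists (side Phi) => //; exact: closed_side.
have : ((xi @` [set z | z \notin Q]) `&` side Phi) z by rewrite E.
by move=> [_ zP]; exact: Xno zX zP zQ.
Qed.

End TriangulatedSurface.

(** * Assembling the bound *)

Lemma genus_minor_sparse (R : realType) (T : finType) (e : rel T) (g : nat) :
  symmetric e -> irreflexive e -> (0 < g)%N -> graph_euler_genus R e g -> minor_sparse e g.
Proof.
move=> e_sym e_irr g0 [[S [surfS [W [K [KS chi]]]] [B [f [f' [[cf _] fB _ ff' _]]]]] _].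
have cpxK := KS.1; have [_ Kpure K2f] := cpxK.
have [_ [k [h [[_ ch] _ hK _ kh]]]] := KS.
have surfK : closed_pseudosurface (simplices K 2).
  split=> [t|s|].
  - by rewrite mem_K2 => /andP[_ /eqP].
  - by rewrite (sides_simplices KS) => /K2f.
  - by move=> Phi; exact: (triangulation_dual_connected surfS KS).
apply: (@embedded_minor_sparse R W K surfK Kpure T e e_sym e_irr (h \o f)) => //.
- apply: within_comp cf _ _; last exact: ch.
  by [].
- by move=> x _; exact: hK.
- move=> x y Gx Gy /= /(congr1 k); rewrite !kh // => /(congr1 f').
  by rewrite !ff'.
rewrite (sides_simplices KS) (card_cover_simplices KS).
by move: chi; rewrite /euler_char; lia.
Qed.

Lemma oriented_chi_le (T : finType) (e : rel T) (D : {set T * T}) (k : nat) :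
  symmetric e -> orientation e D -> oriented_colorable D k -> (oriented_chi D <= k)%N.
Proof.
move=> e_sym oD colk; rewrite /oriented_chi.
case: arg_minnP => [|i _ Hi].
  exact: oriented_colorable_card (orientation_oriented e_sym oD).
have [kT|Tk] := ltnP k #|T|.+1; first exact: (Hi (Ordinal kT)).
exact: leq_trans (ltnW (ltn_ord i)) Tk.
Qed.

Lemma sparse_oriented_chi (T : finType) (e : rel T) (D : {set T * T}) (g d K : nat) :
  symmetric e -> irreflexive e -> (0 < g)%N -> minor_sparse e g -> orientation e D ->
  (23 < d)%N -> (d + d * ('C(d, 2)).+1 <= K)%N ->
  (oriented_chi D <= g + (K.+1 * 2 ^ K.+1) * (g * 2).+1 ^ d)%N.
Proof.
move=> e_sym e_irr g0 sp oD d24 dK.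
have orient u v : if e u v then ((u, v) \in D) (+) ((v, u) \in D) else (u, v) \notin D.
  by have /forallP/(_ u)/forallP/(_ v) := oD.
have De u v : (u, v) \in D -> e u v.
  by move=> uv; have := orient u v; case: (e u v) => //; rewrite uv.
have arcE u v : e u v -> ((u, v) \in D) = ~~ ((v, u) \in D).
  by move=> uv; have := orient u v; rewrite uv; case: (_ \in D); case: (_ \in D).
have [phi [proper consistent]] := oriented_color_map e_sym e_irr sp arcE d24 dK g0.
apply: oriented_chi_le oD _ => //; rewrite -card_color_type.
apply/existsP; exists [ffun u => enum_rank (phi u)]; apply/andP; split.
  apply/forallP => u; apply/forallP => v; apply/implyP => /De uv.
  by rewrite !ffunE (inj_eq enum_rank_inj); exact: proper.
apply/forallP => u; apply/forallP => v; apply/forallP => u'; apply/forallP => v'.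
apply/implyP => /andP[uv vu']; rewrite !ffunE; apply/eqP => -[/enum_rank_inj Eu /enum_rank_inj Ev].
have uv' : e u' v' by rewrite e_sym; exact: De.
(* Equal colors would direct the second edge from [u'] to [v'], against its arc. *)
have := consistent u v u' v' (De _ _ uv) uv' Eu Ev.
by rewrite uv (arcE _ _ uv') vu'.
Qed.

(** Since [2 * g + 1 <= g ^ 2], the power is at most [g ^ 48]; the constant and the sum cost one
    factor each, so already [g ^ 50] suffices. *)
Lemma polynomial_bound (M g : nat) : (M + 3 <= g)%N -> (g + M * (g * 2).+1 ^ 24 <= g ^ 6400)%N.
Proof.
move=> Mg; have g3 : (3 <= g)%N by move: Mg; clear; lia.
have g0 : (0 < g)%N by apply: leq_trans g3.
have M1 : (M <= g)%N by move: Mg; clear; lia.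
have b1 : ((g * 2).+1 ^ 24 <= g ^ 48)%N.
  have -> : (g ^ 48 = (g ^ 2) ^ 24)%N by rewrite -expnM.
  by rewrite leq_exp2r // expnS expn1; move: g3; clear; nia.
apply: (@leq_trans (g ^ 50)); last by rewrite leq_pexp2l.
apply: (@leq_trans (g ^ 49 + g ^ 49)).
  apply: leq_add; first by rewrite -{1}(expn1 g) leq_pexp2l.
  by rewrite [X in (_ <= X)%N]expnS; exact: leq_mul.
by rewrite addnn -mul2n [X in (_ <= X)%N]expnS leq_mul2r; apply/orP; right; exact: ltnW.
Qed.

Theorem theorem1p6 (R : realType) :
  exists g0 : nat,
    forall (T : finType) (e : rel T), symmetric e -> irreflexive e ->
    forall g : nat, (g0 <= g)%N -> graph_euler_genus R e g ->
      (graph_oriented_chi e <= g ^ 6400)%N.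
Proof.
(* The existential hides the value of [K], so that [2 ^ K.+1] is never evaluated. *)
pose d := 24%N; have [K dK] : exists K, (d + d * ('C(d, 2)).+1 <= K)%N by exists (d + d * ('C(d, 2)).+1)%N.
exists (K.+1 * 2 ^ K.+1 + 3)%N => T e e_sym e_irr g gM genus.
have g0 : (0 < g)%N by apply: leq_trans gM; rewrite addnS.
apply/bigmax_leqP => D oD; apply: leq_trans (polynomial_bound gM).
exact: (sparse_oriented_chi e_sym e_irr g0 (genus_minor_sparse e_sym e_irr g0 genus) oD _ dK).
Qed.
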